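(* Let $\mathcal{B}(n,d,d)$ be the set of $d$-regular bipartite graphs with $2n$ nodes and a given bipartition (each side of size $n$). Then the mixing time of the bipartite switch chain on $\mathcal{B}(n,d,d)$ satisfies \[\tau(\varepsilon)\leq 32\,d^{17}n^6\big(2dn\log(2dn)+\log(\varepsilon^{-1})\big).\]
   Context: The bipartite switch chain on a set $\mathcal{B}$ of simple bipartite graphs with fixed bipartition $X,Y$ and fixed degrees is the Markov chain which, from the current graph $B$, with probability $1/2$ does nothing, and otherwise chooses two distinct edges $\{x_1,y_1\},\{x_2,y_2\}$ of $B$ ($x_i\in X$, $y_i\in Y$) uniformly at random and, if $x_1\neq x_2$, $y_1\neq y_2$ and neither $\{x_1,y_2\}$ nor $\{x_2,y_1\}$ is an edge of $B$, replaces the two chosen edges by $\{x_1,y_2\},\{x_2,y_1\}$ (otherwise it stays at $B$). Its stationary distribution is uniform, $\pi$. The mixing time is $\tau(\varepsilon)=\max_{B_0}\min\{T: d_{TV}(P^t(B_0,\cdot),\pi)\leq\varepsilon\text{ for all }t\geq T\}$, where $P^t$ is the $t$-step transition distribution and $d_{TV}$ total variation distance. *)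

(* Defs.v *)
From HB Require Import structures.
From mathcomp Require Import all_boot all_order all_algebra.
From mathcomp Require Import all_classical all_reals all_analysis.
Set Implicit Arguments. Unset Strict Implicit. Unset Printing Implicit Defensive.
Import Order.TTheory GRing.Theory Num.Theory.
Local Open Scope ring_scope.

(* A bipartite graph with parts X = 'I_n and Y = 'I_n is given by its edge
   set, a set of pairs (x, y) with x in X, y in Y. *)
Definition bgraph (n : nat) := {set 'I_n * 'I_n}.

Definition regularb (n d : nat) (B : bgraph n) : bool :=
  [forall x : 'I_n, #|[set y : 'I_n | (x, y) \in B]| == d] &&
  [forall y : 'I_n, #|[set x : 'I_n | (x, y) \in B]| == d].

Definition Bnd (n d : nat) : {set bgraph n} := [set B | regularb d B].

Definition switch (n : nat) (B : bgraph n) (e1 e2 : 'I_n * 'I_n) : bgraph n :=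
  if [&& e1.1 != e2.1, e1.2 != e2.2, (e1.1, e2.2) \notin B
       & (e2.1, e1.2) \notin B]
  then ((B :\ e1) :\ e2) :|: [set (e1.1, e2.2); (e2.1, e1.2)]
  else B.

(* Ordered pairs of distinct edges of B (choosing an unordered pair
   uniformly is the same as choosing an ordered pair uniformly, and the
   switch result does not depend on the order). *)
Definition edge_pairs (n : nat) (B : bgraph n) :
  {set ('I_n * 'I_n) * ('I_n * 'I_n)} :=
  [set p | [&& p.1 \in B, p.2 \in B & p.1 != p.2]].

Definition switchP (R : realType) (n : nat) (B B' : bgraph n) : R :=
  if #|edge_pairs B| == 0%N then ((B == B') : nat)%:R
  else 2^-1 * ((B == B') : nat)%:R
       + 2^-1 * (#|[set p in edge_pairs B | switch B p.1 p.2 == B']|%:R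
                 / #|edge_pairs B|%:R).

Fixpoint switchPt (R : realType) (n : nat) (t : nat) (B0 B : bgraph n) : R :=
  match t with
  | 0%N => ((B0 == B) : nat)%:R
  | t'.+1 => \sum_(C : bgraph n) switchPt R t' B0 C * switchP R C B
  end.

Definition unifB (R : realType) (n d : nat) (B : bgraph n) : R :=
  if B \in Bnd n d then (#|Bnd n d|%:R)^-1 else 0.

Definition dTV (R : realType) (n : nat) (mu nu : bgraph n -> R) : R :=
  2^-1 * \sum_(B : bgraph n) `|mu B - nu B|.

(* Main.v *)
Require Import Defs.
From mathcomp Require Import all_classical all_reals all_analysis.
From mathcomp Require Import all_boot all_order all_algebra all_fingroup.
From mathcomp Require Import zify ring lra.

(** Multicommodity flow.  Given two regular graphs [B1], [B2], two random orders
    on the edge set pair, at every vertex, the edges of [B1 \ B2] with those of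
    [B2 \ B1]; the pairs form alternating circuits, which are processed one
    after the other by switches through a pivot row.  An intermediate graph [Z]
    is, up to at most three entries of the pivot row, [B1] with the edges of a
    set [E] exchanged.  Exchanging [E] in [B2] gives a complementary graph, which
    a bounded modification turns into a regular graph, and exchanging the
    positions of the paired edges inside [E] gives new orders; together with a
    few vertices and edges these data determine [B1], [B2] and the two orders.
    Hence at most [16 n^3 d^12 N] times the number of orders of the paths pass
    through [Z], where [N] is the number of regular graphs.  The paths have at
    most [n d] steps and a switch has probability at least [1 / (n d)^2], which
    gives a Poincare inequality with constant [16 n^6 d^15]; for a lazy symmetric
    chain this constant bounds the decay of the [L^2] distance to uniform. *)

(** Pairings chosen directly would come in a number depending on the degrees in [B1 :\: B2]. Orders
    of all positions are equally many for every pair of graphs, so averaging over the paths becomes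
    plain counting, and exchanging [E] acts on them by a permutation. An order recovers a pairing
    only on the pairs that [E] does not split. The split pairs are few because the exchanged part of
    the current circuit consists of at most two stretches: the row pairing is broken only where the
    circuit starts, the column pairing only at three ends of stretches. These pairs are stored
    separately, and since each lies in one row or column of a graph with degrees at most [d + 1],
    they cost powers of [d] and not of [n]. The other obstacle is that a circuit may revisit its
    pivot row and that the auxiliary entries there may be already present or absent; this is why a
    circuit is cut into phases. *)

Set Implicit Arguments. Unset Strict Implicit. Unset Printing Implicit Defensive.

(** * Order-preserving pairings *)

Section Mate.
Variables (V K : finType) (k : V -> K) (o : V -> nat).
Hypothesis pos_inj : injective o.
Implicit Types (A C D : {set V}) (e : V) (m : V -> V).

Definition class_rank A e := #|[set r in A | (k r == k e) && (o r < o e)]|.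

(** The default of [odflt] is never reached once [A] and [C] have equally many elements in every
    class. *)
Definition mate A C e :=
  if e \in A then odflt e [pick f in C | (k f == k e) && (class_rank C f == class_rank A e)]
  else if e \in C then odflt e [pick f in A | (k f == k e) && (class_rank A f == class_rank C e)]
  else e.

(** Monotonicity inside a class is required instead of equality of ranks because it survives the
    removal of a stable set, whereas ranks change. *)
Record isMate A C m : Prop := IsMate {
  mate_key : forall e, k (m e) = k e;
  mate_invol : involutive m;
  mate_lr : forall e, e \in A -> m e \in C;
  mate_rl : forall e, e \in C -> m e \in A;
  mate_out : forall e, e \notin A -> e \notin C -> m e = e;
  mate_mono : forall e f, e \in A -> f \in A -> k e = k f ->
    o e < o f -> o (m e) < o (m f) }.

Lemma class_rank_lt A e f : e \in A -> k e = k f -> o e < o f -> class_rank A e < class_rank A f.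
Proof.
move=> eA kef oef; apply: proper_card; apply/properP; split.
  apply/subsetP=> r; rewrite !inE => /and3P[-> /eqP-> ore].
  by rewrite kef eqxx (ltn_trans ore).
by exists e; rewrite !inE ?eA ?kef ?eqxx ?oef // ltnn !andbF.
Qed.

Lemma class_rank_inj A e f : e \in A -> f \in A -> k e = k f -> class_rank A e = class_rank A f -> e = f.
Proof.
move=> eA fA kef ref; case: (ltngtP (o e) (o f)) => [lt|lt|/pos_inj//].
  by have := class_rank_lt eA kef lt; rewrite ref ltnn.
by have := class_rank_lt fA (esym kef) lt; rewrite ref ltnn.
Qed.

Lemma class_rank_ltn A e : e \in A -> class_rank A e < #|[set r in A | k r == k e]|.
Proof.
move=> eA; apply: proper_card; apply/properP; split.
  by apply/subsetP=> r; rewrite !inE => /and3P[-> ->].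
by exists e; rewrite !inE eA ?eqxx ?ltnn.
Qed.

(** Pigeonhole: the ranks in a class are distinct and smaller than its size. *)
Lemma class_rank_surj A v i : i < #|[set r in A | k r == v]| ->
  exists2 e, e \in A & k e = v /\ class_rank A e = i.
Proof.
set Av := [set r in A | _] => ltiA.
pose s := map (class_rank A) (enum Av).
have us : uniq s.
  rewrite map_inj_in_uniq ?enum_uniq // => e f.
  rewrite !mem_enum !inE => /andP[eA /eqP ke] /andP[fA /eqP kf].
  by apply: class_rank_inj; rewrite ?ke ?kf.
have ss : {subset s <= iota 0 #|Av|}.
  move=> j /mapP[e]; rewrite mem_enum !inE => /andP[eA /eqP ke] ->.
  by have := class_rank_ltn eA; rewrite ke mem_iota.
have [_ eq_s] : (size s = size (iota 0 #|Av|)) * (s =i iota 0 #|Av|).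
  apply: uniq_min_size => //; by rewrite size_iota size_map -cardE.
have : i \in s by rewrite eq_s mem_iota.
case/mapP=> e; rewrite mem_enum !inE => /andP[eA /eqP ke] ->.
by exists e.
Qed.

(** [m] is a bijection from the elements below [e] in its class onto those below [m e]. Ranks being
    injective on a class, this forces [m]. *)
Lemma isMate_class_rank A C m e : isMate A C m -> e \in A -> class_rank C (m e) = class_rank A e.
Proof.
move=> [mk mi ml mr _ mm] eA; rewrite /class_rank.
set SA := [set r in A | _].
have minj : injective m by apply: inv_inj.
rewrite -(card_imset SA minj); congr #|pred_of_set _|; apply/setP=> r.
apply/idP/imsetP => [|[q]]; rewrite !inE mk.
  case/and3P=> rC /eqP kr lr; exists (m r); last by rewrite mi.
  rewrite !inE mr //= mk kr eqxx /=; case: (ltngtP (o (m r)) (o e)) => // [lt|/pos_inj eq].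
    by move: (mm _ _ eA (mr _ rC)); rewrite mk kr mi => /(_ erefl lt) /ltn_trans/(_ lr); rewrite ltnn.
  by rewrite -eq mi ltnn in lr.
case/and3P=> qA /eqP kq lq -> ; rewrite ml //= mk kq eqxx /=; exact: mm.
Qed.

Lemma isMate_uniq A C m m' : isMate A C m -> isMate A C m' -> m =1 m'.
Proof.
move=> Hm Hm'.
have onA e : e \in A -> m e = m' e.
  move=> eA; apply: (@class_rank_inj C); rewrite ?(mate_lr Hm) ?(mate_lr Hm') //.
    by rewrite (mate_key Hm) (mate_key Hm').
  by rewrite (isMate_class_rank Hm) // (isMate_class_rank Hm').
move=> e; case eA: (e \in A); first exact: onA.
case eC: (e \in C); last by rewrite (mate_out Hm) ?(mate_out Hm') ?eA ?eC.
have := onA _ (mate_rl Hm eC); rewrite (mate_invol Hm) => {2}->.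
by rewrite (mate_invol Hm').
Qed.

Lemma mateP A C : [disjoint A & C] ->
  (forall v, #|[set e in A | k e == v]| = #|[set e in C | k e == v]|) ->
  isMate A C (mate A C).
Proof.
move=> dAC bal.
have fA A' C' e : (forall v, #|[set e in A' | k e == v]| = #|[set e in C' | k e == v]|) ->
  e \in A' -> exists2 f, [pick f in C' | (k f == k e) && (class_rank C' f == class_rank A' e)] = Some f &
    [/\ f \in C', k f = k e & class_rank C' f = class_rank A' e].
  move=> bal' eA; case: pickP => [f /and3P[fC /eqP kf /eqP rf]|no]; first by exists f.
  have := class_rank_ltn eA; rewrite bal' => /class_rank_surj[f fC [kf rf]].
  by have := no f; rewrite fC kf rf !eqxx.
have onA e : e \in A -> [/\ mate A C e \in C, k (mate A C e) = k e & class_rank C (mate A C e) = class_rank A e].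
  by move=> eA; have [f pf H] := fA A C e bal eA; rewrite /mate eA pf.
have notA e : e \in C -> e \in A = false by move=> eC; exact: disjointFl dAC eC.
have onC e : e \in C -> [/\ mate A C e \in A, k (mate A C e) = k e & class_rank A (mate A C e) = class_rank C e].
  move=> eC; have [f pf H] := fA C A e (fun v => esym (bal v)) eC.
  by rewrite /mate (notA e) // eC pf.
have out e : e \notin A -> e \notin C -> mate A C e = e.
  by rewrite /mate => /negbTE-> /negbTE->.
split=> //.
- move=> e; case eA: (e \in A); first by case: (onA e eA).
  case eC: (e \in C); first by case: (onC e eC).
  by rewrite out ?eA ?eC.
- move=> e; case eA: (e \in A).
    case: (onA e eA) => fC kf rf; case: (onC _ fC) => gA kg rg.
    by apply: (@class_rank_inj A); rewrite // ?kg ?kf ?rg ?rf.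
  case eC: (e \in C); last by rewrite !out ?eA ?eC.
  case: (onC e eC) => fC kf rf; case: (onA _ fC) => gA kg rg.
  by apply: (@class_rank_inj C); rewrite // ?kg ?kf ?rg ?rf.
- by move=> e /onA[].
- by move=> e /onC[].
move=> e f eA fA' kef oef.
case: (onA e eA) => meC kme rme; case: (onA f fA') => mfC kmf rmf.
have lt := class_rank_lt eA kef oef.
case: (ltngtP (o (mate A C e)) (o (mate A C f))) => // [l|/pos_inj eq].
  have := class_rank_lt mfC (etrans kmf (etrans (esym kef) (esym kme))) l.
  by rewrite rme rmf => /ltn_trans/(_ lt); rewrite ltnn.
by move: lt; rewrite -rme -rmf eq ltnn.
Qed.

End Mate.

(** * Matchings under restriction and relabelling *)

Section Transport.
Variables (V K : finType) (k : V -> K).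

Lemma isMate_restrict (o : V -> nat) (A C D : {set V}) m : isMate k o A C m ->
  (forall e, e \in D -> m e \in D) ->
  isMate k o (A :\: D) (C :\: D) (fun e => if e \in D then e else m e).
Proof.
move=> [mk mi ml mr mo mm] mD.
have mD' e : (m e \in D) = (e \in D).
  by apply/idP/idP => /mD //; rewrite mi.
split.
- by move=> e; case: ifP.
- by move=> e; case eD: (e \in D); rewrite ?eD // mD' eD mi.
- by move=> e; rewrite !inE => /andP[/negbTE eD eA]; rewrite eD mD' eD ml.
- by move=> e; rewrite !inE => /andP[/negbTE eD eA]; rewrite eD mD' eD mr.
- by move=> e; rewrite !inE; case: ifP => //= _; apply: mo.
by move=> e f; rewrite !inE => /andP[/negbTE -> eA] /andP[/negbTE -> fA]; apply: mm.
Qed.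

(** The relabelling [g] moves the order and both sides together and commutes with [m], so the same
    [m] serves the relabelled data. *)
Lemma isMate_conj (o o' : V -> nat) (A C A' C' : {set V}) (g m : V -> V) :
  involutive g -> (forall e, k (g e) = k e) -> (forall e, o' (g e) = o e) ->
  (forall e, m (g e) = g (m e)) ->
  (forall e, (e \in A') = (g e \in A)) -> (forall e, (e \in C') = (g e \in C)) ->
  isMate k o A C m -> isMate k o' A' C' m.
Proof.
move=> gi gk og mg hA hC [mk mi ml mr mo mm].
have og' e : o' e = o (g e) by rewrite -{1}(gi e) og.
split=> //.
- by move=> e; rewrite hA hC -mg; apply: ml.
- by move=> e; rewrite hA hC -mg; apply: mr.
- move=> e; rewrite hA hC => h1 h2; apply: (inv_inj gi); rewrite -mg; exact: mo.
move=> e f; rewrite !hA !og' -!mg => eA fA kef; apply: mm; by rewrite ?gk.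
Qed.
End Transport.

(** * Counting by codes *)

Section Card.
Variable (T : finType).

Definition card_of (P : T -> Prop) := #|[set w | `[< P w >]]|.

Lemma card_of_sub (P Q : T -> Prop) : (forall w, P w -> Q w) -> card_of P <= card_of Q.
Proof.
by move=> PQ; apply: subset_leq_card; apply/subsetP=> w; rewrite !inE => /asboolP/PQ/asboolP.
Qed.

(** Union bound; nested, it turns a code whose components are chosen successively into a product of
    numbers of choices. *)
Lemma card_of_exists (W : finType) (S : {set W}) (P : W -> T -> Prop) s c :
  #|S| <= s -> (forall w, w \in S -> card_of (P w) <= c) ->
  card_of (fun t => exists2 w, w \in S & P w t) <= s * c.
Proof.
move=> Ss Pc; apply: leq_trans (leq_mul Ss (leqnn c)).
apply: (@leq_trans (\sum_(w in S) card_of (P w))); last first.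
  by rewrite -sum_nat_const; apply: leq_sum.
rewrite {1}/card_of; have -> : [set t | `[< exists2 w, w \in S & P w t >]] = \bigcup_(w in S) [set t | `[< P w t >]].
  apply/setP=> t; rewrite inE; apply/asboolP/bigcupP => [[w wS Pw]|[w wS]].
    by exists w; rewrite ?inE //; apply/asboolP.
  by rewrite inE => /asboolP Pw; exists w.
elim/big_rec2: _ => [|w X Y _ IH]; first by rewrite cards0.
by apply: leq_trans (leq_card_setU _ _).1 _; rewrite leq_add2l.
Qed.

Lemma card_of_and (h : Prop) (P : T -> Prop) c :
  (h -> card_of P <= c) -> card_of (fun t => h /\ P t) <= c.
Proof.
case: (pselect h) => [hh H|nh _].
  by apply: leq_trans (H hh); apply: card_of_sub => w [].
rewrite /card_of (_ : [set w | _] = set0) ?cards0 //.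
by apply/setP=> w; rewrite !inE; apply/asboolP => -[].
Qed.

Lemma card_of_le1 (P : T -> Prop) : (forall u w, P u -> P w -> u = w) -> card_of P <= 1.
Proof.
move=> uniqP; apply/card_le1_eqP => u w; rewrite !inE => /asboolP Pu /asboolP Pw; exact: uniqP.
Qed.
End Card.

(** * Pairings read off from orders *)

Section Pairing.
Variables (V K : finType) (k : V -> K).
Implicit Types (s : {perm V}) (a : V -> V) (A B C D E : {set V}).

Definition position s (e : V) : nat := enum_rank (s e).

Lemma position_inj s : injective (position s).
Proof. by move=> e f /ord_inj/enum_rank_inj/perm_inj. Qed.

Definition pairing s B1 B2 := mate k (position s) (B1 :\: B2) (B2 :\: B1).

Definition is_pairing s B1 B2 a := isMate k (position s) (B1 :\: B2) (B2 :\: B1) a.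

Lemma pairing_memD s B1 B2 a e : is_pairing s B1 B2 a ->
  ((a e \in B1 :\: B2) = (e \in B2 :\: B1)) * ((a e \in B2 :\: B1) = (e \in B1 :\: B2)).
Proof.
move=> [mk mi ml mr mo mm].
by split; apply/idP/idP => [|]; [move/ml|move/mr|move/mr|move/ml]; rewrite ?mi.
Qed.

Lemma pairing_flip s B1 B2 a e : is_pairing s B1 B2 a ->
  (e \in B1) != (e \in B2) -> (a e \in B1) = ~~ (e \in B1).
Proof.
move=> Ha; have := pairing_memD e Ha; rewrite !inE.
by do 4!case: (_ \in _) => //=; case.
Qed.

Lemma pairing_fix s B1 B2 a e : is_pairing s B1 B2 a ->
  (e \in B1) = (e \in B2) -> a e = e.
Proof. by move=> Ha eB; apply: (mate_out Ha); rewrite !inE eB andNb. Qed.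

Lemma pairing_diff s B1 B2 a e : is_pairing s B1 B2 a ->
  ((a e \in B1) != (a e \in B2)) = ((e \in B1) != (e \in B2)).
Proof.
move=> Ha; have := pairing_memD e Ha; rewrite !inE.
by do 4!case: (_ \in _) => //=; case.
Qed.

(** Exchanging [E] swaps the roles of the two edges of a pair inside [E]; swapping also their
    positions in the order keeps them paired. Asking for both edges in [E] makes this an involution
    even if [E] splits pairs. *)
Definition swapin a E e := if (e \in E) && (a e \in E) then a e else e.

Lemma swapin_inv a E : involutive a -> involutive (swapin a E).
Proof.
move=> ai e; rewrite /swapin; case eE: (e \in E) => /=; last by rewrite eE.
by case aE: (a e \in E); rewrite ?ai ?aE ?eE.
Qed.

(* [a] is thus determined, off [D], by [s'], [Zt] and [G]; and [s] can then be
   recovered from [s'], because [swapin a E] is an involution. *)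
Lemma pairing_transfer s s' B1 B2 E D a (Zt G : {set V}) :
  is_pairing s B1 B2 a ->
  (forall e, e \in E -> (e \in B1) != (e \in B2)) ->
  (forall e, e \in D -> a e \in D) ->
  (forall e, e \notin D -> (a e \in E) = (e \in E)) ->
  (forall e, (e \in Zt) = (e \in B1) (+) (e \in E)) ->
  (forall e, (e \in G) = (e \in B2) (+) (e \in E)) ->
  (forall e, s' e = s (swapin a E e)) ->
  isMate k (position s') ((Zt :\: G) :\: D) ((G :\: Zt) :\: D)
    (fun e => if e \in D then e else a e).
Proof.
move=> Ha EH aD aE hZ hG hs.
have ai := mate_invol Ha.
have gi := swapin_inv E ai.
have aD' e : (a e \in D) = (e \in D).
  by apply/idP/idP => /aD //; rewrite ai.
have gD e : (swapin a E e \in D) = (e \in D) by rewrite /swapin; case: ifP => // _; rewrite aD'.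
have key e : (e \notin D) ->
  ((swapin a E e \in B1 :\: B2) = (e \in Zt :\: G)) * ((swapin a E e \in B2 :\: B1) = (e \in G :\: Zt)).
  move=> eD; rewrite /swapin aE // andbb.
  have := EH e; have := pairing_memD e Ha; rewrite !inE hZ hG; case: (e \in E) => /=.
    move=> -[-> ->] /(_ isT).
    by case: (e \in B1); case: (e \in B2).
  by rewrite !addbF.
apply: (isMate_conj (g := swapin a E) _ _ _ _ _ _ (isMate_restrict Ha aD)) => //.
- by move=> e; rewrite /swapin; case: ifP => // _; rewrite (mate_key Ha).
- by move=> e; rewrite /position hs gi.
- move=> e; rewrite gD; case: ifP => // _.
  rewrite /swapin ai [(a e \in E) && _]andbC; by case: ifP => //; rewrite ai.
- move=> e; rewrite in_setD [in RHS]in_setD gD; case eD: (e \in D) => //=.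
  by rewrite key ?eD.
- move=> e; rewrite in_setD [in RHS]in_setD gD; case eD: (e \in D) => //=.
  by rewrite key ?eD.
Qed.
End Pairing.

(** This is why an unordered set of two edges is enough to store a split pair. *)
Lemma set2_pair (V : finType) (a a' : V -> V) (e f g : V) :
  involutive a -> involutive a' -> a e != e -> a' f != f ->
  [set e; a e] = [set f; a' f] -> g \in [set e; a e] -> a g = a' g.
Proof.
move=> ai ai' ne nf eqs.
have h1 : f \in [set e; a e] by rewrite eqs !inE eqxx.
have h2 : a' f \in [set e; a e] by rewrite eqs !inE eqxx orbT.
have [[fe afe]|[fe afe]] : (f = e /\ a' f = a e) \/ (f = a e /\ a' f = e).
  move: h1 h2 nf; rewrite !inE => /orP[] /eqP-> /orP[] /eqP->; rewrite ?eqxx //; by [left|right].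
- by rewrite !inE => /orP[] /eqP->; [rewrite -afe fe|rewrite ai -afe ai' fe].
- by rewrite !inE => /orP[] /eqP->; [rewrite -{2}afe ai' fe|rewrite ai -fe afe].
Qed.

(** * Decoding a graph on a path *)

Section Through.
Variable n : nat.
Notation V := ('I_n * 'I_n)%type.
Implicit Types (B Z E G : {set V}) (a b : V -> V) (r e f : V) (x y : 'I_n).

(** The components are the alternating circuits; a position on which the two graphs agree is fixed
    by both pairings and is a component by itself. *)
Definition link a b : rel V := fun e f => (f == a e) || (f == b e).

(** Addition modulo 2 lets equal columns cancel, so that one formula covers a single entry and three
    entries. *)
Definition chord x y1 y2 y3 e :=
  (e.1 == x) && ((e.2 == y1) (+) (e.2 == y2) (+) (e.2 == y3)).

(** In every case toggling the chords lowers the degree of row [x] by exactly one. *)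
Definition chords_ok Z x y1 y2 y3 :=
  [|| (y3 == y1) && ((x, y2) \in Z), (y3 == y2) && ((x, y1) \in Z)
    | [&& y1 != y2, y1 != y3, y2 != y3, (x, y1) \in Z, (x, y2) \in Z & (x, y3) \notin Z]].

(* [E] is the set of exchanged edges: the circuits that precede the current one
   (that of [r0]) and a part of the current one.  The triple [e1], [e2], [e3]
   may be constant, which is why [e3] is allowed to be like [e1] and [e2]. *)
Record through B1 B2 a b Z E r0 y1 y2 y3 e1 e2 e3 : Prop := Through {
  th_H : forall e, e \in E -> (e \in B1) != (e \in B2);
  th_out : forall e, (e \in B1) != (e \in B2) -> ~~ connect (link a b) r0 e ->
    (e \in E) = (enum_rank (fingraph.root (link a b) e) < enum_rank (fingraph.root (link a b) r0));
  th_r0 : r0 \in B1 :\: B2;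
  th_r0E : r0 \in E;
  th_ar0 : a r0 \notin E;
  th_a : forall e, e != r0 -> e != a r0 -> (a e \in E) = (e \in E);
  th_b : forall e, e \notin [set e1; b e1] -> e \notin [set e2; b e2] ->
    e \notin [set e3; b e3] -> (b e \in E) = (e \in E);
  th_e1 : [/\ (e1 \in B1) != (e1 \in B2), e1.2 = y1, (e1 \in B2) (+) (e1 \in E) &
    (b e1 \in B2) (+) (b e1 \in E)];
  th_e2 : [/\ (e2 \in B1) != (e2 \in B2), e2.2 = y2, (e2 \in B2) (+) (e2 \in E) &
    (b e2 \in B2) (+) (b e2 \in E)];
  th_e3 : [/\ (e3 \in B1) != (e3 \in B2), e3.2 = y3 &
    (((e3 \in B2) (+) (e3 \in E)) && ((b e3 \in B2) (+) (b e3 \in E))) ||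
    (((e3 \in B1) (+) (e3 \in E)) && ((b e3 \in B1) (+) (b e3 \in E)))];
  th_Z : forall e, (e \in Z) = (e \in B1) (+) (e \in E) (+) chord r0.1 y1 y2 y3 e;
  th_y : chords_ok Z r0.1 y1 y2 y3 }.

(** [Zt], [G] and the modified orders determine the pairings off the split pairs, which are given;
    so the circuits are known. Membership in [B1] alternates along the circuit of [r0], which yields
    [E] there, and [th_out] yields [E] on the other circuits. Undoing the exchange then gives
    everything else. *)
Lemma through_uniq B1 B2 C1 C2 s1 s2 t1 t2 a1 a2 b1 b2 Z E1 E2 r0 y1 y2 y3 e1 e2 e3 f1 f2 f3 :
  is_pairing fst s1 B1 B2 a1 -> is_pairing snd t1 B1 B2 b1 ->
  is_pairing fst s2 C1 C2 a2 -> is_pairing snd t2 C1 C2 b2 ->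
  through B1 B2 a1 b1 Z E1 r0 y1 y2 y3 e1 e2 e3 ->
  through C1 C2 a2 b2 Z E2 r0 y1 y2 y3 f1 f2 f3 ->
  (forall e, (e \in B2) (+) (e \in E1) = (e \in C2) (+) (e \in E2)) ->
  a1 r0 = a2 r0 -> [set e1; b1 e1] = [set f1; b2 f1] ->
  [set e2; b1 e2] = [set f2; b2 f2] -> [set e3; b1 e3] = [set f3; b2 f3] ->
  (forall e, s1 (swapin a1 E1 e) = s2 (swapin a2 E2 e)) ->
  (forall e, t1 (swapin b1 E1 e) = t2 (swapin b2 E2 e)) ->
  [/\ B1 = C1, B2 = C2, s1 = s2 & t1 = t2].
Proof.
move=> Ha1 Hb1 Ha2 Hb2 T1 T2 eG ear A1 A2 A3 es et.
pose Zt := [set e | (e \in Z) (+) chord r0.1 y1 y2 y3 e].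
pose G := [set e | (e \in B2) (+) (e \in E1)].
have hZ1 e : (e \in Zt) = (e \in B1) (+) (e \in E1).
  by rewrite inE (th_Z T1) -addbA addbb addbF.
have hZ2 e : (e \in Zt) = (e \in C1) (+) (e \in E2).
  by rewrite inE (th_Z T2) -addbA addbb addbF.
have hG1 e : (e \in G) = (e \in B2) (+) (e \in E1) by rewrite inE.
have hG2 e : (e \in G) = (e \in C2) (+) (e \in E2) by rewrite inE eG.
(* Exchanging the same set in two graphs preserves their symmetric difference, here that of [Zt] and
   [G]. *)
have diff e : ((e \in B1) != (e \in B2)) = ((e \in C1) != (e \in C2)).
  have := hZ1 e; have := hG1 e; rewrite hZ2 hG2.
  by case: (e \in B1); case: (e \in B2); case: (e \in C1); case: (e \in C2);
     case: (e \in E1); case: (e \in E2).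
have nfix k s B B' a e : is_pairing k s B B' a -> (e \in B) != (e \in B') -> a e != e.
  by move=> Ha /(pairing_flip Ha); apply: contra_eqN => /eqP->; case: (e \in B).
have ai1 := mate_invol Ha1; have ai2 := mate_invol Ha2.
have bi1 := mate_invol Hb1; have bi2 := mate_invol Hb2.
have setJ (b : V -> V) e f : involutive b -> f \in [set e; b e] -> b f \in [set e; b e].
  by move=> bi; rewrite !inE => /orP[] /eqP->; rewrite ?bi eqxx ?orbT.
have ea : a1 = a2.
  pose D := [set r0; a1 r0].
  pose s' := (perm (inv_inj (swapin_inv E1 ai1)) * s1)%g.
  have hs1 e : s' e = s1 (swapin a1 E1 e) by rewrite permM permE.
  have hs2 e : s' e = s2 (swapin a2 E2 e) by rewrite hs1 es.
  have M1 : isMate fst (position s') ((Zt :\: G) :\: D) ((G :\: Zt) :\: D) (fun e => if e \in D then e else a1 e).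
    apply: (pairing_transfer Ha1 (th_H T1) _ _ hZ1 hG1 hs1) => e; first exact: setJ.
    by rewrite !inE negb_or => /andP[]; apply: (th_a T1).
  have M2 : isMate fst (position s') ((Zt :\: G) :\: D) ((G :\: Zt) :\: D) (fun e => if e \in D then e else a2 e).
    apply: (pairing_transfer Ha2 (th_H T2) _ _ hZ2 hG2 hs2) => e; first by rewrite /D ear; exact: setJ.
    by rewrite !inE ear negb_or => /andP[]; apply: (th_a T2).
  apply: functional_extensionality_dep => e; have := isMate_uniq (@position_inj _ _) M1 M2 e.
  by rewrite !inE; case: eqP => [-> _|_]; last case: eqP => [-> _|//]; rewrite ?ear // ai2 -ear ai1.
have eb : b1 = b2.
  pose D := [set e1; b1 e1] :|: [set e2; b1 e2] :|: [set e3; b1 e3].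
  have D2 : D = [set f1; b2 f1] :|: [set f2; b2 f2] :|: [set f3; b2 f3] by rewrite -A1 -A2 -A3.
  pose s' := (perm (inv_inj (swapin_inv E1 bi1)) * t1)%g.
  have hs1 e : s' e = t1 (swapin b1 E1 e) by rewrite permM permE.
  have hs2 e : s' e = t2 (swapin b2 E2 e) by rewrite hs1 et.
  have M1 : isMate snd (position s') ((Zt :\: G) :\: D) ((G :\: Zt) :\: D) (fun e => if e \in D then e else b1 e).
    apply: (pairing_transfer Hb1 (th_H T1) _ _ hZ1 hG1 hs1) => e.
      by rewrite 2!in_setU => /orP[/orP[]|] /(setJ _ _ _ bi1) h; rewrite 2!in_setU h ?orbT.
    by rewrite 2!in_setU !negb_or => /andP[/andP[]]; apply: (th_b T1).
  have M2 : isMate snd (position s') ((Zt :\: G) :\: D) ((G :\: Zt) :\: D) (fun e => if e \in D then e else b2 e).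
    apply: (pairing_transfer Hb2 (th_H T2) _ _ hZ2 hG2 hs2) => e; rewrite D2.
      by rewrite 2!in_setU => /orP[/orP[]|] /(setJ _ _ _ bi2) h; rewrite 2!in_setU h ?orbT.
    by rewrite 2!in_setU !negb_or => /andP[/andP[]]; apply: (th_b T2).
  apply: functional_extensionality_dep => e.
  case eD: (e \in D); last by have := isMate_uniq (@position_inj _ _) M1 M2 e; rewrite eD.
  have [p1 _ _ _] := th_e1 T1; have [q1 _ _ _] := th_e1 T2.
  have [p2 _ _ _] := th_e2 T1; have [q2 _ _ _] := th_e2 T2.
  have [p3 _ _] := th_e3 T1; have [q3 _ _] := th_e3 T2.
  move: eD; rewrite 2!in_setU => /orP[/orP[]|] h.
  - exact: (set2_pair bi1 bi2 (nfix _ _ _ _ _ _ _ Hb1 p1) (nfix _ _ _ _ _ _ _ Hb2 q1) A1 h).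
  - exact: (set2_pair bi1 bi2 (nfix _ _ _ _ _ _ _ Hb1 p2) (nfix _ _ _ _ _ _ _ Hb2 q2) A2 h).
  - exact: (set2_pair bi1 bi2 (nfix _ _ _ _ _ _ _ Hb1 p3) (nfix _ _ _ _ _ _ _ Hb2 q3) A3 h).
subst a2 b2.
have conB e : connect (link a1 b1) r0 e -> (e \in B1) = (e \in C1).
  case/connectP=> p; elim/last_ind: p e => [e _ ->|p f IH e].
    by have := th_r0 T1; have := th_r0 T2; rewrite !inE => /andP[_ ->] /andP[_ ->].
  rewrite rcons_path last_rcons => /andP[pth lk] ->.
  have {}IH := IH _ pth erefl.
  have step k s s' a : is_pairing k s B1 B2 a -> is_pairing k s' C1 C2 a ->
      (a (last r0 p) \in B1) = (a (last r0 p) \in C1).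
    move=> H1 H2; case h: ((last r0 p \in B1) != (last r0 p \in B2)).
      by rewrite (pairing_flip H1) // (pairing_flip H2) -?diff // IH.
    rewrite (pairing_fix H1) //; exact/eqP/negbFE.
  by case/orP: lk => /eqP->; [apply: step Ha1 Ha2|apply: step Hb1 Hb2].
have eE e : (e \in E1) = (e \in E2).
  case con: (connect (link a1 b1) r0 e).
    by have := hZ1 e; rewrite hZ2 (conB e con); case: (e \in C1); case: (e \in E1); case: (e \in E2).
  case h: ((e \in B1) != (e \in B2)).
    by rewrite (th_out T1) ?con // (th_out T2) ?con // -diff.
  apply/idP/idP => [/(th_H T1)|/(th_H T2)]; by rewrite -?diff h.
have eB1 : B1 = C1.
  by apply/setP=> e; have := hZ1 e; rewrite hZ2 eE; case: (e \in E2); case: (e \in C1); case: (e \in B1).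
have eB2 : B2 = C2.
  by apply/setP=> e; have := hG1 e; rewrite hG2 eE; case: (e \in E2); case: (e \in C2); case: (e \in B2).
have {}eE : E1 = E2 by apply/setP.
subst E2; split=> //; apply/permP=> e.
  by have := es (swapin a1 E1 e); rewrite swapin_inv.
by have := et (swapin b1 E1 e); rewrite swapin_inv.
Qed.
End Through.

(** * Counting the paths through a graph *)

Section Degree.
Variables (V K : finType) (k : V -> K).
Implicit Types (A B C D : {set V}) (v : K).

Definition kdeg A v := #|[set e in A | k e == v]|.

Lemma kdeg_sum A v : kdeg A v = \sum_(e | k e == v) (e \in A).
Proof.
rewrite /kdeg -sum1_card (eq_bigl (fun e => (k e == v) && (e \in A))).
  by rewrite -big_mkcondr.
by move=> e; rewrite inE andbC.
Qed.

(** [A] arises from [B] by deleting [ps] and adding [qs]; the additive form reduces every degree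
    computation to linear arithmetic. *)
Lemma kdeg_move A B (ps qs : seq V) :
  (forall e, (e \in A) + count_mem e ps = (e \in B) + count_mem e qs) ->
  forall v, kdeg A v + count (fun p => k p == v) ps =
            kdeg B v + count (fun p => k p == v) qs.
Proof.
move=> H v.
have aux (s : seq V) : count (fun p => k p == v) s = \sum_(e | k e == v) count_mem e s.
  elim: s => [|p s IH]; first by rewrite big1.
  rewrite /= big_split /= -IH; congr (_ + _).
  case kp: (k p == v); last first.
    rewrite big1 // => e /eqP ke; case: eqP => // ep; by rewrite ep ke eqxx in kp.
  rewrite (bigD1 p) //= eqxx big1 // => e /andP[_ ne].
  by rewrite eq_sym (negbTE ne).
rewrite !aux !kdeg_sum -!big_split /=; exact: eq_bigr.
Qed.

Lemma kdeg_add A B C D : (forall e, (e \in A) + (e \in B) = (e \in C) + (e \in D)) ->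
  forall v, kdeg A v + kdeg B v = kdeg C v + kdeg D v.
Proof. by move=> H v; rewrite !kdeg_sum -!big_split /=; apply: eq_bigr. Qed.

Lemma is_pairingP s B1 B2 : (forall v, kdeg B1 v = kdeg B2 v) ->
  is_pairing k s B1 B2 (pairing k s B1 B2).
Proof.
move=> eqd; apply: mateP; first exact: position_inj.
  rewrite -setI_eq0; apply/eqP/setP=> e; rewrite !inE.
  by case: (e \in B1); case: (e \in B2).
move=> v; have := eqd v; rewrite /kdeg.
rewrite -(cardsID [set e in B2 | k e == v]) -[in RHS](cardsID [set e in B1 | k e == v]).
rewrite setIC => /addnI.
set X := _ :\: _; set Y := _ :\: _ => eXY.
have -> : [set e in B1 :\: B2 | k e == v] = X.
  by apply/setP=> e; rewrite !inE; case: (k e == v); rewrite ?andbT ?andbF.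
rewrite eXY; apply: eq_card => e; rewrite !inE; by case: (k e == v); rewrite ?andbT ?andbF.
Qed.

Lemma card_kdeg A : #|A| = \sum_v kdeg A v.
Proof.
rewrite -sum1_card (partition_big k predT) //=; apply: eq_bigr => v _.
by rewrite /kdeg -sum1_card; apply: eq_bigl => e; rewrite inE.
Qed.
End Degree.

(** * Regular graphs and the repair of degree defects *)

Section Regular.
Variables (n d : nat).
Notation V := ('I_n * 'I_n)%type.
Implicit Types (B G Z : {set V}) (x y : 'I_n) (e : V).

Lemma kdeg_fst B x : kdeg fst B x = #|[set y : 'I_n | (x, y) \in B]|.
Proof.
rewrite /kdeg -(card_imset [set y | (x, y) \in B] (f := pair x)) => [|u v [] //].
apply: eq_card => -[u v]; rewrite !inE; apply/andP/imsetP => [[uv /eqP /= ux]|[w]].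
  by exists v; rewrite ?inE -?ux.
by rewrite inE => xw [-> ->].
Qed.

Lemma kdeg_snd B y : kdeg snd B y = #|[set x : 'I_n | (x, y) \in B]|.
Proof.
rewrite /kdeg -(card_imset [set x | (x, y) \in B] (f := fun x => (x, y))) => [|u v [] //].
apply: eq_card => -[u v]; rewrite !inE; apply/andP/imsetP => [[uv /eqP /= vy]|[w]].
  by exists u; rewrite ?inE -?vy.
by rewrite inE => xw [-> ->].
Qed.

Lemma BndP B : reflect ((forall x, kdeg fst B x = d) /\ (forall y, kdeg snd B y = d))
  (B \in Bnd n d).
Proof.
rewrite inE; apply: (iffP andP) => -[/= h1 h2]; split.
- by move=> x; rewrite kdeg_fst; apply/eqP/(forallP h1).
- by move=> y; rewrite kdeg_snd; apply/eqP/(forallP h2).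
- by apply/forallP=> x; rewrite -kdeg_fst h1.
- by apply/forallP=> y; rewrite -kdeg_snd h2.
Qed.

Lemma card_Bnd B : B \in Bnd n d -> #|B| = n * d.
Proof.
case/BndP=> h _; rewrite (card_kdeg fst) (eq_bigr (fun=> d)) //.
by rewrite sum_nat_const card_ord.
Qed.

Lemma kdeg_gt0 (k : V -> 'I_n) B v : 0 < kdeg k B v -> exists2 e, e \in B & k e = v.
Proof. by case/card_gt0P=> e; rewrite inE => /andP[eB /eqP ke]; exists e. Qed.

Lemma kdeg_fst_lt G x x' : kdeg fst G x' < kdeg fst G x ->
  exists2 y, (x, y) \in G & (x', y) \notin G.
Proof.
rewrite !kdeg_fst => lt.
have : ~~ ([set y | (x, y) \in G] \subset [set y | (x', y) \in G]).
  by apply: contraL lt => /subset_leq_card; rewrite leqNgt.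
by case/subsetPn=> y; rewrite !inE; exists y.
Qed.

Lemma kdeg_snd_lt G y y' : kdeg snd G y' < kdeg snd G y ->
  exists2 x, (x, y) \in G & (x, y') \notin G.
Proof.
rewrite !kdeg_snd => lt.
have : ~~ ([set x | (x, y) \in G] \subset [set x | (x, y') \in G]).
  by apply: contraL lt => /subset_leq_card; rewrite leqNgt.
by case/subsetPn=> x; rewrite !inE; exists x.
Qed.

(* Inverse of the removal of an excess at [x0] and [y]; an edge [e'] in the row
   of [x0] encodes that the edge [(x0, y)] itself was removed. *)
Definition unexcess x0 y (G1 : {set V}) (e' : V) : {set V} :=
  if e'.1 == x0 then (x0, y) |: G1
  else (x0, e'.2) |: ((e'.1, y) |: (G1 :\ e')).

(** If [(x0, y)] is absent, take an edge [(x', y)]. Row [x0] is larger than row [x'], so for some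
    [y'] the edges [(x0, y')] and [(x', y)] can be replaced by the single edge [(x', y')], which is
    the code [e']. *)
Lemma excess_removal G x0 y : 0 < d ->
  (forall x, kdeg fst G x = d + (x == x0)) -> 0 < kdeg snd G y ->
  exists G1 e', [/\ e' \in G1, unexcess x0 y G1 e' = G,
    forall x, kdeg fst G1 x = d & forall z, kdeg snd G1 z + (z == y) = kdeg snd G z].
Proof.
move=> d_gt0 hr hy; case G0: ((x0, y) \in G).
  have mv e : (e \in G :\ (x0, y)) + count_mem e [:: (x0, y)] = (e \in G) + count_mem e [::].
    by rewrite !inE /= eq_sym; case: eqP => [<-|_]; rewrite ?G0 //=.
  have r x : kdeg fst (G :\ (x0, y)) x = d.
    by have := kdeg_move fst mv x; rewrite /= hr [x0 == x]eq_sym; case: (x == x0) => /=; lia.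
  (* Since [d > 0], row [x0] still has an edge to signal this case. *)
  have [|e' e'G e'x] := @kdeg_gt0 fst (G :\ (x0, y)) x0; first by rewrite r.
  exists (G :\ (x0, y)), e'; split=> //.
    by rewrite /unexcess e'x eqxx; apply/setP=> e; rewrite !inE; case: eqP => [->|].
  by move=> z; have := kdeg_move snd mv z; rewrite /= !addn0 [y == z]eq_sym.
have [[x' ?] eG /= ?] := kdeg_gt0 hy; subst.
have nx : x' != x0 by apply: contraFneq G0 => <-.
have [|y' y'G y'N] := @kdeg_fst_lt G x0 x'; first by rewrite !hr eqxx (negbTE nx); lia.
have ny : y' != y by apply: contraNneq y'N => ->.
pose G1 := (x', y') |: (G :\ (x0, y') :\ (x', y)).
have mv e : (e \in G1) + count_mem e [:: (x0, y'); (x', y)] = (e \in G) + count_mem e [:: (x', y')].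
  rewrite !inE /= ![(_, _) == e]eq_sym.
  have [->|n1] := eqVneq e (x', y').
    by rewrite (negbTE y'N) !xpair_eqE (negbTE nx) (negbTE ny) !andbF.
  have [->|n2] := eqVneq e (x', y); first by rewrite eG xpair_eqE (negbTE nx).
  by have [->|n3] := eqVneq e (x0, y'); rewrite ?y'G //=; case: (_ \in _).
exists G1, (x', y'); split.
- by rewrite !inE eqxx.
- rewrite /unexcess /= (negbTE nx); apply/setP=> e; rewrite !inE.
  have [->|n1] := eqVneq e (x0, y'); first by rewrite y'G.
  have [->|n2] := eqVneq e (x', y); first by rewrite eG.
  by have [->|n3] := eqVneq e (x', y'); rewrite ?(negbTE y'N).
- move=> x; have := kdeg_move fst mv x; rewrite /= hr [x0 == x]eq_sym; move: (kdeg _ G1 x) (x == x0) (x' == x) => m [] []; lia.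
- by move=> z; have := kdeg_move snd mv z; rewrite /= [y == z]eq_sym; move: (kdeg _ G1 z) (kdeg _ G z) (z == y) (y' == z) => m1 m2 [] []; lia.
Qed.

(** Some row meets the larger column and misses the smaller one; its edge is moved. To undo this one
    only needs [x], a neighbour of [y3] in [G']. *)
Lemma excess_shift G y2 y3 : kdeg snd G y3 < kdeg snd G y2 ->
  exists x G', [/\ (x, y3) \in G', G = (x, y2) |: (G' :\ (x, y3)),
    forall z, kdeg fst G' z = kdeg fst G z
    & forall z, kdeg snd G' z + (z == y2) = kdeg snd G z + (z == y3)].
Proof.
move=> lt; have [x x2 x3] := kdeg_snd_lt lt.
have ny : y2 != y3 by apply: contraNneq x3 => <-.
pose G' := (x, y3) |: (G :\ (x, y2)).
have mv e : (e \in G') + count_mem e [:: (x, y2)] = (e \in G) + count_mem e [:: (x, y3)].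
  rewrite !inE /= ![(_, _) == e]eq_sym.
  have [->|n1] := eqVneq e (x, y2); first by rewrite x2 xpair_eqE (negbTE ny) andbF.
  by have [->|n2] := eqVneq e (x, y3); rewrite ?(negbTE x3) //=.
exists x, G'; split.
- by rewrite !inE eqxx.
- apply/setP=> e; rewrite !inE; have [->|n1] := eqVneq e (x, y2); first by rewrite x2.
  by have [->|n2] := eqVneq e (x, y3); rewrite ?(negbTE x3).
- by move=> z; have := kdeg_move fst mv z => /= /addIn.
- by move=> z; have := kdeg_move snd mv z; rewrite /= !addn0 ![_ == z]eq_sym.
Qed.

End Regular.

(** * Number of complementary graphs *)

Section Counting.
Variables (n d : nat).
Notation V := ('I_n * 'I_n)%type.
Implicit Types (B G Z : {set V}) (x y : 'I_n) (e : V).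
Hypothesis d_gt0 : 0 < d.

Definition toggled Z x y1 y2 y3 : {set V} := [set e | (e \in Z) (+) chord x y1 y2 y3 e].

Lemma chords_okP Z x y1 y2 y3 : chords_ok Z x y1 y2 y3 ->
  let ym := if y3 == y1 then y2 else y1 in
  ((y3 == y1) || (y3 == y2) /\
   forall e, (e \in toggled Z x y1 y2 y3) + count_mem e [:: (x, ym)] =
             (e \in Z) + count_mem e [::]) \/
  (((y3 == y1) || (y3 == y2)) = false /\
   forall e, (e \in toggled Z x y1 y2 y3) + count_mem e [:: (x, y1); (x, y2)] =
             (e \in Z) + count_mem e [:: (x, y3)]).
Proof.
have dE (e : V) y : ((x, y) == e) = (e.1 == x) && (e.2 == y) by rewrite eq_sym; case: e.
case/or3P => [/andP[/eqP-> Z2]|/andP[/eqP-> Z1]|].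
- rewrite eqxx; left; split=> // e; rewrite inE /chord /= dE addn0.
  have h : e.1 = x -> e.2 = y2 -> e \in Z by case: (e) => u v /= -> ->.
  by move: h; case: (e.2 == y1); case: eqP => // e1; case: eqP => // e2; rewrite ?addbF ?addn0 // => ->.
- left; split=> [|e]; first by rewrite eqxx orbT.
  have -> : (if y2 == y1 then y2 else y1) = y1 by case: eqP.
  rewrite inE /chord /= dE addn0.
  have h : e.1 = x -> e.2 = y1 -> e \in Z by case: (e) => u v /= -> ->.
  by move: h; case: (e.2 == y2); case: eqP => // e1; case: eqP => // e2; rewrite ?addbF ?addn0 // => ->.
case/and5P=> n12 n13 n23 Z1 /andP[Z2 Z3]; right; rewrite ![y3 == _]eq_sym.
rewrite (negbTE n13) (negbTE n23); split=> // e; rewrite inE /chord /= !dE !addn0.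
case e1: (e.1 == x); rewrite ?addbF //=.
have eE y : (e.2 == y) -> e = (x, y) by move=> /eqP <-; rewrite -(eqP e1) -surjective_pairing.
case e2: (e.2 == y1).
  by rewrite (eE _ e2) Z1 /= (negbTE n12) (negbTE n13).
case e3: (e.2 == y2).
  by rewrite (eE _ e3) Z2 /= (negbTE n23).
case e4: (e.2 == y3); last by rewrite /= addbF.
by rewrite (eE _ e4) (negbTE Z3).
Qed.

(** Candidates for the complementary graph, which together with the toggled graph has the same
    edges, with multiplicity, as [B1] and [B2]; only the degrees are kept. *)
Definition exchanged Z x y1 y2 y3 : {set {set V}} :=
  [set G | [forall v, kdeg fst G v + kdeg fst (toggled Z x y1 y2 y3) v == 2 * d] &&
           [forall v, kdeg snd G v + kdeg snd (toggled Z x y1 y2 y3) v == 2 * d]].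

Lemma exchanged_deg Z x y1 y2 y3 G : Z \in Bnd n d -> chords_ok Z x y1 y2 y3 ->
  G \in exchanged Z x y1 y2 y3 ->
  [/\ forall v, kdeg fst G v = d + (v == x),
      forall v, kdeg snd G v <= d.+1 &
      forall v, kdeg snd (toggled Z x y1 y2 y3) v <= d.+1].
Proof.
move=> /BndP[Z1 Z2] ok; rewrite inE => /andP[/forallP h1 /forallP h2].
have {}h1 v := eqP (h1 v); have {}h2 v := eqP (h2 v).
case: (chords_okP ok) => -[yy mv]; split=> v.
- have := kdeg_move fst mv v; have := h1 v; rewrite /= Z1 [x == v]eq_sym.
  move: (kdeg _ _ v) (kdeg _ G v) (v == x) => a b []; lia.
- have := kdeg_move snd mv v; have := h2 v; rewrite /= Z2.
  move: (kdeg _ _ v) (kdeg _ G v) (_ == v) => a b []; lia.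
- have := kdeg_move snd mv v; rewrite /= Z2.
  move: (kdeg _ _ v) (_ == v) => b []; lia.
- have := kdeg_move fst mv v; have := h1 v; rewrite /= Z1 [x == v]eq_sym.
  move: (kdeg _ _ v) (kdeg _ G v) (v == x) => a b []; lia.
- have := kdeg_move snd mv v; have := h2 v; rewrite /= Z2.
  (* With three distinct chords no column of [G] can gain two edges, whence the bound [d.+1]. *)
  have : y1 = v -> y2 = v -> false.
    move=> e1 e2; move: ok yy; rewrite /chords_ok e1 e2 eqxx /= orbF.
    by case/orP=> /andP[->].
  case: eqP => e1; case: eqP => e2; rewrite ?e1 ?e2 /=; [by move/(_ erefl erefl)|move=> _..]; move: (kdeg _ _ v) (kdeg _ G v) (y3 == v) => a b []; lia.
- have := kdeg_move snd mv v; rewrite /= Z2.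
  move: (kdeg _ _ v) (y1 == v) (y2 == v) (y3 == v) => b [] [] []; lia.
Qed.

(** The excess of row [x] and column [ym] is removed; with three distinct chords the remaining
    excess of column [y2] is then shifted to [y3]. The factors count the regular graph [G'], the row
    [x'] of the shift and the edge [e] of the removal. *)
Lemma card_exchanged Z x y1 y2 y3 : Z \in Bnd n d -> chords_ok Z x y1 y2 y3 ->
  #|exchanged Z x y1 y2 y3| <= #|Bnd n d| * (d * (n * d)).
Proof.
move=> ZB ok; pose ym := if y3 == y1 then y2 else y1.
pose unshift x' (G : {set V}) :=
  if (y3 == y1) || (y3 == y2) then G else (x', y2) |: (G :\ (x', y3)).
pose P G' x' e G := G = unexcess x ym (unshift x' G') e.
apply: (@leq_trans (card_of (fun G => exists2 G' : {set V}, G' \in Bnd n d & exists2 x' : 'I_n,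
  x' \in [set v | (v, y3) \in G'] & exists2 e : V, e \in unshift x' G' & P G' x' e G))).
  apply: subset_leq_card; apply/subsetP=> G GE; rewrite inE; apply/asboolP.
  have [Gr Gc _] := exchanged_deg ZB ok GE.
  have /BndP[Z1 Z2] := ZB.
  move: GE; rewrite inE => /andP[_ /forallP h2].
  have {}h2 v := eqP (h2 v).
  have Gm : kdeg snd G ym = d.+1.
    case: (chords_okP ok) => -[yy mv].
      have := kdeg_move snd mv ym; rewrite /= eqxx /= Z2; have := h2 ym.
      move: (kdeg _ _ _) (kdeg _ G _) => a b; lia.
    have ymE : ym = y1 by rewrite /ym; case: eqP yy.
    have := kdeg_move snd mv ym; rewrite /= Z2 ymE eqxx; have := h2 y1.
    have [y31 y32] : (y3 == y1) = false /\ (y2 == y1) = false.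
      move: ok yy; rewrite /chords_ok; case: (y3 == y1) => //=; case: (y3 == y2) => //=.
      by rewrite eq_sym; case: (y2 == y1).
    rewrite y31 y32; move: (kdeg _ _ _) (kdeg _ G _) => a b; lia.
  have [|G1 [e [eG1 GE r1 c1]]] := excess_removal (y := ym) d_gt0 Gr; first by rewrite Gm.
  case: (chords_okP ok) => -[yy mv].
    have G1B : G1 \in Bnd n d.
      apply/BndP; split=> // v; have := c1 v; have := kdeg_move snd mv v; have := h2 v.
      rewrite /= Z2 -/ym [ym == v]eq_sym.
      move: (kdeg _ _ v) (kdeg _ G v) (kdeg _ G1 v) (v == ym) => a b c []; lia.
    (* Nothing is shifted in this case; [x'] is any neighbour of [y3]. *)
    have [|[x' y'] e'G /= e'y] := @kdeg_gt0 _ snd G1 y3; first by case/BndP: G1B => _ ->.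
    exists G1 => //; exists x'; first by rewrite inE -e'y.
    by exists e; rewrite /P /unshift yy.
  have [y31 y21] : (y3 == y1) = false /\ (y2 == y1) = false.
    move: ok yy; rewrite /chords_ok; case: (y3 == y1) => //=; case: (y3 == y2) => //=.
    by rewrite eq_sym; case: (y2 == y1).
  have y32 : (y3 == y2) = false by case: (y3 == y2) yy; rewrite ?orbT.
  have ymE : ym = y1 by rewrite /ym y31.
  have deg2 v : kdeg snd G1 v + (v == y3) = d + (v == y2).
    have := c1 v; have := kdeg_move snd mv v; have := h2 v; rewrite /= Z2 ymE.
    rewrite ![_ == v]eq_sym.
    move: (kdeg _ _ v) (kdeg _ G v) (kdeg _ G1 v) (v == y1) (v == y2) (v == y3) => a b c [] [] []; lia.
  have lt : kdeg snd G1 y3 < kdeg snd G1 y2.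
    have := deg2 y3; have := deg2 y2; rewrite !eqxx [y2 == y3]eq_sym y32 /=.
    move: (kdeg _ G1 _) (kdeg _ G1 _) => a b; lia.
  have [x' [G' [x'G' G1E r2 c2]]] := excess_shift lt.
  exists G'.
    apply/BndP; split=> v; first by rewrite r2.
    have := deg2 v; have := c2 v; move: (kdeg _ _ _) (kdeg _ G1 _) => a b; lia.
  exists x'; first by rewrite inE.
  by exists e; rewrite /P /unshift yy -G1E.
apply: card_of_exists => // G' G'B; apply: card_of_exists => [|x' x'G'].
  by rewrite -kdeg_snd; case/BndP: G'B => _ ->.
rewrite -[n * d]muln1; apply: card_of_exists => [|e _]; last first.
  by apply: card_of_le1 => u w -> ->.
have cG' := card_Bnd G'B.
rewrite /unshift; case: ifP => _; first by rewrite cG'.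
apply: leq_trans (_ : (#|G' :\ (x', y3)|).+1 <= _).
  by rewrite cardsU1; case: (_ \notin _); rewrite ?add1n ?add0n.
by rewrite inE in x'G'; rewrite -cG' [in X in _ <= X](cardsD1 (x', y3)) x'G'.
Qed.
End Counting.

(** * Number of paths through a graph *)

Section Passes.
Variables (n d : nat).
Notation V := ('I_n * 'I_n)%type.
Notation Om := ((bgraph n * bgraph n) * ({perm V} * {perm V}))%type.
Implicit Types (A B G Z E : {set V}) (x y : 'I_n) (e : V) (w : Om).

Definition pair_x w := pairing fst w.2.1 w.1.1 w.1.2.
Definition pair_y w := pairing snd w.2.2 w.1.1 w.1.2.

Definition passes Z w := exists E r0 y1 y2 y3 e1 e2 e3,
  through w.1.1 w.1.2 (pair_x w) (pair_y w) Z E r0 y1 y2 y3 e1 e2 e3.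

Lemma Bnd_pairing w : w.1.1 \in Bnd n d -> w.1.2 \in Bnd n d ->
  is_pairing fst w.2.1 w.1.1 w.1.2 (pair_x w) /\
  is_pairing snd w.2.2 w.1.1 w.1.2 (pair_y w).
Proof.
move=> /BndP[r1 c1] /BndP[r2 c2].
by split; apply: is_pairingP => v; rewrite ?r1 ?c1 ?r2 ?c2.
Qed.

Definition two_edges (A : {set V}) y : {set {set V}} :=
  [set C : {set V} | (C \subset [set e in A | e.2 == y]) && (#|C| == 2)].

Lemma card_two_edges A y : 0 < d -> kdeg snd A y <= d.+1 -> #|two_edges A y| <= d ^ 2.
Proof.
move=> d_gt0 ; rewrite /two_edges cards_draws -/(kdeg snd A y).
set m := kdeg _ _ _; move=> mle.
apply: leq_trans (leq_bin2l 2 mle) _; rewrite bin2 /=.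
by case: d d_gt0 => // c _; rewrite expnS expn1; lia.
Qed.

Definition pair_edge (a : V -> V) (e : V) := [set e; a e].

Lemma pair_two_edges s B1 B2 b A y e : is_pairing snd s B1 B2 b ->
  (e \in B1) != (e \in B2) -> e.2 = y -> e \in A -> b e \in A ->
  pair_edge b e \in two_edges A y.
Proof.
move=> Hb df ey eA bA; rewrite inE; apply/andP; split; last first.
  rewrite cards2; suff -> : e != b e by [].
  by apply/eqP=> h; have := pairing_flip Hb df; rewrite -h; case: (e \in B1).
apply/subsetP=> f; rewrite !inE => /orP[] /eqP->; rewrite ?eA ?bA ?(mate_key Hb) ey eqxx //.
Qed.

(** The factors: [n] for the pivot row, [n] for [y3], [2 d] each for [y1] and [y2], [N n d^2] for
    the complementary graph, [2 d] and [d] for the row pair split at [r0], [d^2], [d^2] and [2 d^2]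
    for the column pairs, and all permutations for [s] and [t]. *)
Lemma card_passes Z : 0 < d -> Z \in Bnd n d ->
  card_of (fun w => [/\ w.1.1 \in Bnd n d, w.1.2 \in Bnd n d & passes Z w]) <=
  16 * n ^ 3 * d ^ 12 * (#|Bnd n d| * (#|{: {perm V}}| * #|{: {perm V}}|)).
Proof.
move=> d_gt0 ZB; set N := #|Bnd n d|; set T := #|{: {perm V}}|.
(* By [chords_ok], [y1] and [y2] are neighbours of [x] in [Z] or equal to [y3], so there are at most
   [d + 1 <= 2 d] choices for each. *)
pose nbr x y3 := y3 |: [set y | (x, y) \in Z].
pose row G x := [set e in G | e.1 == x].
pose last_step y1 y2 y3 G r0 r1 A1 A2 A3 (s t : {perm V}) w :=
  [/\ w.1.1 \in Bnd n d, w.1.2 \in Bnd n d & exists E e1 e2 e3,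
   [/\ through w.1.1 w.1.2 (pair_x w) (pair_y w) Z E r0 y1 y2 y3 e1 e2 e3,
     forall e, (e \in G) = (e \in w.1.2) (+) (e \in E),
     pair_x w r0 = r1,
     [/\ A1 = pair_edge (pair_y w) e1, A2 = pair_edge (pair_y w) e2 &
         A3 = pair_edge (pair_y w) e3] &
     (forall e, s e = w.2.1 (swapin (pair_x w) E e)) /\
     (forall e, t e = w.2.2 (swapin (pair_y w) E e))]].
pose code w :=
  exists2 x, x \in [set: 'I_n] & exists2 y3, y3 \in [set: 'I_n] &
  exists2 y1, y1 \in nbr x y3 & exists2 y2, y2 \in nbr x y3 &
  chords_ok Z x y1 y2 y3 /\
  exists2 G, G \in exchanged d Z x y1 y2 y3 &
  exists2 r0, r0 \in row G x & exists2 r1, r1 \in row G x :\ r0 &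
  exists2 A1, A1 \in two_edges G y1 & exists2 A2, A2 \in two_edges G y2 &
  exists2 A3, A3 \in two_edges G y3 :|: two_edges (toggled Z x y1 y2 y3) y3 &
  exists2 s, s \in [set: {perm V}] & exists2 t, t \in [set: {perm V}] &
  last_step y1 y2 y3 G r0 r1 A1 A2 A3 s t w.
apply: (@leq_trans (card_of code)).
  apply: card_of_sub => w [B1 B2 [E [r0 [y1 [y2 [y3 [e1 [e2 [e3 T0]]]]]]]]].
  have [Ha Hb] := Bnd_pairing B1 B2.
  pose G : {set V} := [set e | (e \in w.1.2) (+) (e \in E)].
  have ok := th_y T0.
  exists r0.1; rewrite ?inE //; exists y3; rewrite ?inE //.
  have nb : (y1 \in nbr r0.1 y3) && (y2 \in nbr r0.1 y3).
    rewrite !inE; move: ok; case/or3P => [/andP[/eqP-> ->]|/andP[/eqP-> ->]|].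
    - by rewrite eqxx orbT.
    - by rewrite eqxx orbT.
    by case/and5P=> _ _ _ -> /andP[->]; rewrite !orbT.
  case/andP: nb => nb1 nb2; exists y1 => //; exists y2 => //; split=> //.
  have tE e : (e \in toggled Z r0.1 y1 y2 y3) = (e \in w.1.1) (+) (e \in E).
    by rewrite inE (th_Z T0) -addbA addbb addbF.
  have GE e : (e \in G) + (e \in toggled Z r0.1 y1 y2 y3) = (e \in w.1.2) + (e \in w.1.1).
    rewrite tE inE; case eE: (e \in E); last by rewrite !addbF.
    by have := th_H T0 eE; case: (e \in w.1.1); case: (e \in w.1.2).
  have [/BndP[r1 c1] /BndP[r2 c2]] := (B1, B2).
  exists G.
    rewrite inE; apply/andP; split; apply/forallP=> v; apply/eqP; rewrite (kdeg_add _ GE).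
      by rewrite r1 r2; lia.
    by rewrite c1 c2; lia.
  have := th_r0 T0; rewrite inE => /andP[r02 r01].
  have ar0 := pairing_memD r0 Ha.
  (* [r0] is in [E] and not in [B2], its partner is in [B2] and not in [E]; so both are in the pivot
     row of [G]. *)
  exists r0; first by rewrite !inE eqxx (negbTE r02) (th_r0E T0).
  exists (pair_x w r0).
    have := ar0; rewrite !inE (mate_key Ha) eqxx (negbTE r02) r01 /= => -[h1 h2].
    case/andP: h2 => h3 h4; rewrite h4 (negbTE (th_ar0 T0)) /= andbT.
    by apply: contraNneq h3 => ->.
  have [d1 k1 l1 m1] := th_e1 T0; have [d2 k2 l2 m2] := th_e2 T0.
  have [d3 k3 lm3] := th_e3 T0.
  exists (pair_edge (pair_y w) e1); first by apply: (pair_two_edges Hb); rewrite ?inE.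
  exists (pair_edge (pair_y w) e2); first by apply: (pair_two_edges Hb); rewrite ?inE.
  exists (pair_edge (pair_y w) e3).
    rewrite in_setU; case/orP: lm3 => /andP[l3 m3]; apply/orP; [left|right].
      by apply: (pair_two_edges Hb); rewrite ?inE.
    by apply: (pair_two_edges Hb); rewrite ?tE.
  exists (perm (inv_inj (swapin_inv E (mate_invol Ha))) * w.2.1)%g; rewrite ?inE //.
  exists (perm (inv_inj (swapin_inv E (mate_invol Hb))) * w.2.2)%g; rewrite ?inE //.
  split=> //; exists E, e1, e2, e3; split=> //; first by move=> e; rewrite inE.
  by split=> e; rewrite permM permE.
have -> : 16 * n ^ 3 * d ^ 12 * (N * (T * T)) =
  n * (n * (2 * d * (2 * d * (N * (d * (n * d)) * (2 * d * (d * (d ^ 2 * (d ^ 2 * (d ^ 2 + d ^ 2)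
   * (T * T))))))))).
  by rewrite !expnS !expn0; lia.
apply: card_of_exists => [|x _]; first by rewrite cardsT card_ord.
apply: card_of_exists => [|y3 _]; first by rewrite cardsT card_ord.
have nbrle : #|nbr x y3| <= 2 * d.
  have /BndP[zr _] := ZB; rewrite cardsU1 -kdeg_fst zr.
  by case: (_ \notin _) => /=; lia.
apply: card_of_exists => // y1 _; apply: card_of_exists => // y2 _.
apply: card_of_and => ok.
apply: card_of_exists => [|G GE]; first exact: card_exchanged.
have [Gr Gc Zc] := exchanged_deg d_gt0 ZB ok GE.
have rowE : #|row G x| = d.+1 by rewrite -/(kdeg fst G x) Gr eqxx addn1.
apply: card_of_exists => [|r0 r0G]; first by rewrite rowE; lia.
apply: card_of_exists => [|r1 _].
  by rewrite -ltnS -[d.+1]rowE (cardsD1 r0 (row G x)) r0G.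
apply: card_of_exists => [|A1 _]; first exact: card_two_edges.
rewrite -mulnA.
apply: card_of_exists => [|A2 _]; first exact: card_two_edges.
apply: card_of_exists => [|A3 _].
  apply: leq_trans (leq_card_setU _ _).1 _; apply: leq_add; exact: card_two_edges.
apply: card_of_exists => [|s _]; first by rewrite cardsT.
rewrite -[T]muln1; apply: card_of_exists => [|t _]; first by rewrite cardsT.
apply: card_of_le1 => -[[B1 B2] [s1 t1]] [[C1 C2] [s2 t2]].
case=> /= B1B B2B [E1 [e1 [e2 [e3 [T1 G1 ar1 [a1 a2 a3] [hs1 ht1]]]]]].
case=> /= C1B C2B [E2 [f1 [f2 [f3 [T2 G2 ar2 [c1 c2 c3] [hs2 ht2]]]]]].
have [/= Ha1 Hb1] := @Bnd_pairing ((B1, B2), (s1, t1)) B1B B2B.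
have [/= Ha2 Hb2] := @Bnd_pairing ((C1, C2), (s2, t2)) C1B C2B.
have [|||||||-> -> -> -> //] := through_uniq Ha1 Hb1 Ha2 Hb2 T1 T2.
- by move=> e; rewrite -G1 -G2.
- by rewrite ar1 ar2.
- by rewrite -/(pair_edge _ _) -a1 c1.
- by rewrite -/(pair_edge _ _) -a2 c2.
- by rewrite -/(pair_edge _ _) -a3 c3.
- by move=> e; rewrite -hs1 -hs2.
by move=> e; rewrite -ht1 -ht2.
Qed.
End Passes.

(** * Paths of switches *)

Section Switching.
Variables (n d : nat).
Notation V := ('I_n * 'I_n)%type.
Implicit Types (B Z : {set V}) (x y : 'I_n) (e : V).

Definition switchable Z e1 e2 := [&& e1 \in Z, e2 \in Z, e1.1 != e2.1, e1.2 != e2.2,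
  (e1.1, e2.2) \notin Z & (e2.1, e1.2) \notin Z].

Definition switch_adj (Z Z' : {set V}) :=
  [exists e1, exists e2, switchable Z e1 e2 && (Z' == switch Z e1 e2)].

Lemma switch_mem Z e1 e2 e : switchable Z e1 e2 ->
  (e \in switch Z e1 e2) + count_mem e [:: e1; e2] =
  (e \in Z) + count_mem e [:: (e1.1, e2.2); (e2.1, e1.2)].
Proof.
case: e1 e2 => [x1 y1] [x2 y2] /and5P[/= i1 i2 nx ny /andP[no1 no2]].
rewrite /switch /= nx ny no1 no2 /= !inE ![(_, _) == e]eq_sym.
have [->|n1] := eqVneq e (x1, y1).
  by rewrite i1 !xpair_eqE !eqxx (negbTE nx) (negbTE ny) !andbF.
have [->|n2] := eqVneq e (x2, y2).
  by rewrite i2 !xpair_eqE !eqxx ![_ == x1]eq_sym ![_ == y1]eq_sym (negbTE nx) (negbTE ny) !andbF.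
have [->|n3] := eqVneq e (x1, y2).
  by rewrite (negbTE no1) xpair_eqE (negbTE nx).
have [->|n4] := eqVneq e (x2, y1); first by rewrite (negbTE no2).
by rewrite /= !orbF.
Qed.

Lemma adjacent_Bnd Z Z' : Z \in Bnd n d -> switch_adj Z Z' -> Z' \in Bnd n d.
Proof.
move=> /BndP[r c] /existsP[e1 /existsP[e2 /andP[sw /eqP->]]].
apply/BndP; split=> v.
  have := kdeg_move fst (fun e => switch_mem e sw) v => /= /addIn ->; exact: r.
have := kdeg_move snd (fun e => switch_mem e sw) v => /=.
rewrite [X in _ = _ + X]addnCA => /addIn ->; exact: c.
Qed.

Lemma adjacent_intro Z Z' x0 x y y' : x0 != x ->
  (x0, y') \in Z -> (x, y) \in Z -> (x0, y) \notin Z -> (x, y') \notin Z ->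
  (forall e, (e \in Z') = (e \in Z) (+) (e == (x, y)) (+) (e == (x, y'))
                           (+) (e == (x0, y)) (+) (e == (x0, y'))) ->
  switch_adj Z Z'.
Proof.
move=> nx i1 i2 no1 no2 H.
have ny : y' != y by apply: contraNneq no1 => <-.
have sw : switchable Z (x0, y') (x, y) by rewrite /switchable i1 i2 /= nx ny no1 no2.
apply/existsP; exists (x0, y'); apply/existsP; exists (x, y); rewrite sw.
apply/eqP/setP=> e; have := switch_mem e sw; rewrite H /= ![(_, _) == e]eq_sym.
have [->|n1] := eqVneq e (x, y).
  by rewrite i2 !xpair_eqE !eqxx ![_ == x0]eq_sym ![_ == y']eq_sym (negbTE nx) (negbTE ny) !andbF /=; case: (_ \in _).
have [->|n2] := eqVneq e (x, y').
  by rewrite (negbTE no2) !xpair_eqE !eqxx ![_ == x0]eq_sym (negbTE nx) /=; case: (_ \in _).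
have [->|n3] := eqVneq e (x0, y).
  by rewrite (negbTE no1) !xpair_eqE !eqxx ![_ == y']eq_sym (negbTE ny) andbF /=; case: (_ \in _).
have [->|n4] := eqVneq e (x0, y'); first by rewrite i1; case: (_ \in _).
by rewrite /= !addbF; do 2!case: (_ \in _).
Qed.
End Switching.

Section Reach.
Variables (T : Type) (e : rel T).

Definition reach k x y := exists p, [/\ path e x p, last x p = y & size p <= k].

Lemma reach_refl k x : reach k x x.
Proof. by exists [::]. Qed.

Lemma reach_trans k l x y z : reach k x y -> reach l y z -> reach (k + l) x z.
Proof.
move=> [p [pp lp sp]] [q [pq lq sq]]; exists (p ++ q).
by rewrite cat_path last_cat lp pp pq lq size_cat leq_add.
Qed.

Lemma reach_step x y : e x y -> reach 1 x y.
Proof. by move=> exy; exists [:: y]; rewrite /= exy. Qed.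

Lemma reach_leq k l x y : k <= l -> reach k x y -> reach l x y.
Proof. by move=> kl [p [? ? /leq_trans h]]; exists p; split=> //; apply: h. Qed.
End Reach.

(** * Processing the alternating circuits *)

Section Circuit.
Variables (n d : nat).
Notation V := ('I_n * 'I_n)%type.
Notation Om := ((bgraph n * bgraph n) * ({perm V} * {perm V}))%type.
Variable w : Om.
Notation B1 := w.1.1.
Notation B2 := w.1.2.
Notation a := (pair_x w).
Notation b := (pair_y w).
Hypothesis B1B : B1 \in Bnd n d.
Hypothesis B2B : B2 \in Bnd n d.

Let Ha : is_pairing fst w.2.1 B1 B2 a := (Bnd_pairing B1B B2B).1.
Let Hb : is_pairing snd w.2.2 B1 B2 b := (Bnd_pairing B1B B2B).2.
Let ai : involutive a := mate_invol Ha.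
Let bi : involutive b := mate_invol Hb.

Notation lk := (link a b).
Notation rnk e := (enum_rank (fingraph.root lk e) : nat).
Notation H e := ((e \in B1) != (e \in B2)).

(** A step is charged to its source: [passes] and regularity are asked of [Z], and [adjacent_Bnd]
    gives the regularity of [Z']. *)
Definition flow_step : rel (bgraph n) := fun Z Z' =>
  [&& Z \in Bnd n d, switch_adj Z Z' & `[< passes Z w >]].

Lemma link_sym : connect_sym lk.
Proof.
apply: sym_connect_sym => e f; rewrite /link.
by rewrite ![f == _]eq_sym (inv_eq ai) (inv_eq bi).
Qed.

Lemma root_a e : fingraph.root lk (a e) = fingraph.root lk e.
Proof. by apply/eqP; rewrite (root_connect link_sym) link_sym; apply: connect1; rewrite /link eqxx. Qed.

Lemma root_b e : fingraph.root lk (b e) = fingraph.root lk e.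
Proof. by apply/eqP; rewrite (root_connect link_sym) link_sym; apply: connect1; rewrite /link eqxx orbT. Qed.

Definition done_before k : {set V} := [set e | H e && (rnk e < k)].

Definition stage k : {set V} := [set e | (e \in B1) (+) (e \in done_before k)].

Lemma stage_mem k e : (e \in stage k) = (e \in B1) (+) (H e && (rnk e < k)).
Proof. by rewrite !inE. Qed.

Section Fixed.
Variable r0 : V.
Hypothesis r0R : r0 \in B1 :\: B2.

(** One turn leads from an edge of [B1 :\: B2] to the next one on the circuit: [b] stays in the
    column and gives [new_edge t], then [a] stays in the row and gives [old_edge t.+1]. *)
Definition turn e := a (b e).
Definition old_edge t := iter t turn r0.
Definition new_edge t := b (old_edge t).
Definition xrow t := (old_edge t).1.
Definition ycol t := (old_edge t).2.
Definition period := fingraph.order turn r0.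

Lemma turn_inj : injective turn.
Proof. exact: inj_comp (inv_inj ai) (inv_inj bi). Qed.

Lemma period_gt0 : 0 < period. Proof. exact: fingraph.order_gt0. Qed.

Lemma old_edge_period : old_edge period = old_edge 0. Proof. exact: iter_order turn_inj r0. Qed.

Lemma old_edge_eq t u : t < period -> u < period -> (old_edge t == old_edge u) = (t == u).
Proof.
move=> tm um; apply/eqP/eqP => [|->//] h.
by rewrite -(findex_iter tm) -(findex_iter um) -/(old_edge t) h.
Qed.

Lemma pair_new_edge t : a (new_edge t) = old_edge t.+1. Proof. by []. Qed.

Lemma pair_old_edge t : a (old_edge t.+1) = new_edge t. Proof. by rewrite -pair_new_edge ai. Qed.

Lemma old_edge_in t : old_edge t \in B1 :\: B2.
Proof.
elim: t => // t IH; rewrite -pair_new_edge (pairing_memD _ Ha).1.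
by rewrite (pairing_memD _ Hb).2.
Qed.

Lemma new_edge_in t : new_edge t \in B2 :\: B1.
Proof. by rewrite (pairing_memD _ Hb).2 old_edge_in. Qed.

Lemma old_edge_mem t : ((old_edge t \in B1) = true) * ((old_edge t \in B2) = false).
Proof. by have := old_edge_in t; rewrite inE => /andP[/negbTE -> ->]. Qed.

Lemma new_edge_mem t : ((new_edge t \in B2) = true) * ((new_edge t \in B1) = false).
Proof. by have := new_edge_in t; rewrite inE => /andP[/negbTE -> ->]. Qed.

Lemma new_old_edge t u : (new_edge t == old_edge u) = false.
Proof. by apply/eqP=> h; have := new_edge_mem t; rewrite h old_edge_mem; case. Qed.

Lemma new_edge_eq t u : t < period -> u < period -> (new_edge t == new_edge u) = (t == u).
Proof. by move=> tm um; rewrite (inj_eq (inv_inj bi)) old_edge_eq. Qed.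

Lemma old_edgeE t : old_edge t = (xrow t, ycol t). Proof. exact: surjective_pairing. Qed.

Lemma new_edgeE t : new_edge t = (xrow t.+1, ycol t).
Proof.
rewrite [new_edge t]surjective_pairing; congr pair; last exact: (mate_key Hb).
by rewrite /xrow -pair_new_edge (mate_key Ha).
Qed.

Lemma connect_cases e : connect lk r0 e -> exists2 t, t < period & e = old_edge t \/ e = new_edge t.
Proof.
case/connectP=> p; elim/last_ind: p e => [e _ ->|p f IH e].
  by exists 0; [exact: period_gt0|left].
rewrite rcons_path last_rcons => /andP[pth l] ->.
have [t tm [] ht] := IH _ pth erefl; move: l; rewrite ht /link => /orP[] /eqP ->.
(* The circuit closes up: the row partner of [old_edge 0] is the last new edge. *)
- case: t tm ht => [|t] tm _; last by exists t; [exact: ltnW|right; rewrite pair_old_edge].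
  exists period.-1; first by rewrite prednK ?period_gt0.
  by right; rewrite -old_edge_period -{1}(prednK period_gt0) pair_old_edge.
- by exists t => //; right.
- move: tm; rewrite leq_eqVlt => /orP[/eqP tm|tm]; last by exists t.+1; [|left; rewrite pair_new_edge].
  by exists 0; [exact: period_gt0|left; rewrite pair_new_edge tm old_edge_period].
by exists t => //; left; rewrite /new_edge bi.
Qed.

Lemma connect_new_edge t : connect lk r0 (old_edge t) -> connect lk r0 (new_edge t).
Proof. by move=> h; apply: connect_trans h _; apply: connect1; rewrite /link eqxx orbT. Qed.

Lemma connect_old_edge t : connect lk r0 (old_edge t).
Proof.
elim: t => [|t IH]; first exact: connect0.
apply: connect_trans (connect_new_edge IH) _; apply: connect1; by rewrite /link pair_new_edge eqxx.
Qed.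

Lemma root_connect_r0 e : connect lk r0 e -> rnk e = rnk r0.
Proof. by rewrite -(root_connect link_sym) => /eqP->. Qed.

Definition flipped p j i : {set V} :=
  [set old_edge t | t : 'I_period & (t <= p) || (j < t <= i)] :|:
  [set new_edge t | t : 'I_period & (t < p) || (j <= t < i)].

Lemma flipped_old_edge p j i t : t < period -> (old_edge t \in flipped p j i) = (t <= p) || (j < t <= i).
Proof.
move=> tm; rewrite inE orbC; case: imsetP => [[u _ /esym/eqP]|_ /=]; first by rewrite new_old_edge.
apply/imsetP/idP => [[u]|h]; last by exists (Ordinal tm); rewrite ?inE.
by rewrite inE => h /eqP; rewrite old_edge_eq // => /eqP->.
Qed.

Lemma flipped_new_edge p j i t : t < period -> (new_edge t \in flipped p j i) = (t < p) || (j <= t < i).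
Proof.
move=> tm; rewrite inE; case: imsetP => [[u _ /eqP]|_ /=]; first by rewrite new_old_edge.
apply/imsetP/idP => [[u]|h]; last by exists (Ordinal tm); rewrite ?inE.
by rewrite inE => h /eqP; rewrite new_edge_eq // => /eqP->.
Qed.

Lemma flipped_connect p j i e : e \in flipped p j i -> connect lk r0 e.
Proof.
by rewrite inE => /orP[] /imsetP[t _ ->]; [|apply: connect_new_edge]; apply: connect_old_edge.
Qed.

Definition mixed p j i : {set V} := done_before (rnk r0) :|: flipped p j i.

Lemma mixed_old_edge p j i t : t < period -> (old_edge t \in mixed p j i) = (t <= p) || (j < t <= i).
Proof.
by move=> tm; rewrite inE flipped_old_edge // inE (root_connect_r0 (connect_old_edge t)) ltnn andbF.
Qed.

Lemma mixed_new_edge p j i t : t < period -> (new_edge t \in mixed p j i) = (t < p) || (j <= t < i).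
Proof.
by move=> tm; rewrite inE flipped_new_edge // inE (root_connect_r0 (connect_new_edge (connect_old_edge t))) ltnn andbF.
Qed.

Lemma mixed_out p j i e : ~~ connect lk r0 e -> (e \in mixed p j i) = H e && (rnk e < rnk r0).
Proof.
move=> h; rewrite inE; case hp: (e \in flipped p j i); first by rewrite (flipped_connect hp) in h.
by rewrite orbF inE.
Qed.

(* Link [t] of the circuit replaces [(xrow t, ycol t)] by [(xrow t, ycol t.-1)]
   while a token of the pivot row [xrow 0] jumps from [ycol t.-1] to the empty
   column [ycol t].  In [state p j i] the links up to [p] and those between [j]
   and [i] have been performed: the hole that was at [ycol i] has moved back to
   [ycol j], and it reaches [ycol p] at the end of the phase. *)
Definition state p j i : {set V} :=
  [set e | (e \in B1) (+) (e \in mixed p j i) (+) chord (xrow 0) (ycol p) (ycol i) (ycol j) e].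

Lemma xrow_period : xrow period = xrow 0. Proof. by rewrite /xrow old_edge_period. Qed.

(** [old_edge t.+1] and [new_edge t], paired by [a], are always exchanged together; the one
    exception is the pair of [r0] and the last new edge. *)
Lemma mixed_props p j i : p <= j <= i -> i < period -> 
  [/\ forall e, e \in mixed p j i -> H e,
      forall e, H e -> ~~ connect lk r0 e -> (e \in mixed p j i) = (rnk e < rnk r0),
      r0 \in mixed p j i, a r0 \notin mixed p j i &
      forall e, e != r0 -> e != a r0 -> (a e \in mixed p j i) = (e \in mixed p j i)].
Proof.
move=> /andP[pj ji] im.
have ar0 : a r0 = new_edge period.-1 by rewrite -[r0]/(old_edge 0) -old_edge_period -{1}(prednK period_gt0) pair_old_edge.
have m1 : period.-1 < period by rewrite prednK ?period_gt0.
split.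
- move=> e; rewrite !inE => /orP[/andP[]//|] /orP[] /imsetP[t _ ->]; by rewrite ?old_edge_mem ?new_edge_mem.
- by move=> e He hc; rewrite mixed_out // He.
- by rewrite -[r0]/(old_edge 0) mixed_old_edge ?period_gt0.
- rewrite ar0 mixed_new_edge //; lia.
move=> e n0 n1; case hc: (connect lk r0 e); last first.
  rewrite !mixed_out ?hc // ?root_a ?(pairing_diff _ Ha) //.
  by rewrite -(root_connect link_sym) root_a (root_connect link_sym) hc.
have [t tm [et|et]] := connect_cases hc; subst e.
  case: t tm n0 n1 {hc} => [|t] tm; first by rewrite eqxx.
  by move=> _ _; rewrite pair_old_edge mixed_new_edge ?mixed_old_edge //; lia.
move: n1; rewrite ar0 new_edge_eq // => n1.
by rewrite pair_new_edge mixed_old_edge ?mixed_new_edge //; lia.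
Qed.

(** [old_edge t] and [new_edge t], paired by [b], are exchanged together except at the ends [p], [j]
    and [i] of the stretches; for [j = i] the second stretch is empty. *)
Lemma mixed_b p j i e : p <= j <= i -> i < period -> 
  e \notin [set old_edge p; new_edge p] -> (j < i -> e \notin [set old_edge i; new_edge i] /\ e \notin [set old_edge j; new_edge j]) ->
  (b e \in mixed p j i) = (e \in mixed p j i).
Proof.
move=> /andP[pj ji] im np nij; case hc: (connect lk r0 e); last first.
  rewrite !mixed_out ?hc // ?root_b ?(pairing_diff _ Hb) //.
  by rewrite -(root_connect link_sym) root_b (root_connect link_sym) hc.
have [t tm et] := connect_cases hc.
have ntp : t != p.
  by apply: contra np => /eqP <-; rewrite !inE; case: et => ->; rewrite eqxx ?orbT.
have nt : j < i -> t != i /\ t != j.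
  move=> /nij[ni nj]; split; [apply: contra ni|apply: contra nj] => /eqP <-;
  by rewrite !inE; case: et => ->; rewrite eqxx ?orbT.
suff key : (old_edge t \in mixed p j i) = (new_edge t \in mixed p j i).
  by case: et => ->; rewrite -/(new_edge t) // /new_edge bi -/(new_edge t) key.
rewrite mixed_old_edge // mixed_new_edge //; case: (ltnP j i) => [/nt|]; lia.
Qed.

Lemma state_mem p j i e :
  (e \in state p j i) = (e \in B1) (+) (e \in mixed p j i) (+) chord (xrow 0) (ycol p) (ycol i) (ycol j) e.
Proof. by rewrite inE. Qed.

(** At [p] and [i] the old edge is exchanged and the new one is not, so both are in the
    complementary graph. At [j] it is the reverse, so both are in the toggled graph: hence the two
    alternatives of [th_e3]. *)
Lemma passes_mid p j i : p < j -> j < i -> i < period ->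
  chords_ok (state p j i) (xrow 0) (ycol p) (ycol i) (ycol j) -> passes (state p j i) w.
Proof.
move=> pj ji im ok.
have pji : p <= j <= i by rewrite (ltnW pj) (ltnW ji).
have [P1 P2 P3 P4 P5] := mixed_props pji im.
have jm := ltn_trans ji im; have pm := ltn_trans pj jm.
have nlt k : ~~ (k < k) by rewrite ltnn.
exists (mixed p j i), r0, (ycol p), (ycol i), (ycol j), (old_edge p), (old_edge i), (old_edge j).
apply: (Through P1 P2 r0R P3 P4 P5 _ _ _ _ (@state_mem p j i) ok).
- by move=> e n1 n2 n3; apply: (mixed_b pji im n1).
- rewrite -/(new_edge p) !old_edge_mem !new_edge_mem mixed_old_edge // mixed_new_edge //; split=> //; lia.
- rewrite -/(new_edge i) !old_edge_mem !new_edge_mem mixed_old_edge // mixed_new_edge //; split=> //; lia.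
- rewrite -/(new_edge j) !old_edge_mem !new_edge_mem mixed_old_edge // mixed_new_edge //; split=> //; lia.
Qed.

(** For [j = i] two chords cancel, and the constant triple at [p] describes the same graph. *)
Lemma passes_start p i : p < i -> i < period ->
  (xrow 0, ycol p) \in state p i i -> passes (state p i i) w.
Proof.
move=> pi im F.
have pji : p <= i <= i by rewrite leqnn ltnW.
have [P1 P2 P3 P4 P5] := mixed_props pji im.
have pm := ltn_trans pi im.
have e_ok : [/\ H (old_edge p), (old_edge p).2 = ycol p, (old_edge p \in B2) (+) (old_edge p \in mixed p i i) &
  (b (old_edge p) \in B2) (+) (b (old_edge p) \in mixed p i i)].
  rewrite -/(new_edge p) !old_edge_mem !new_edge_mem mixed_old_edge // mixed_new_edge //; split=> //; lia.
exists (mixed p i i), r0, (ycol p), (ycol p), (ycol p), (old_edge p), (old_edge p), (old_edge p).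
apply: (Through P1 P2 r0R P3 P4 P5 _ e_ok e_ok).
- by move=> e n1 n2 n3; apply: (mixed_b pji im n1); rewrite ltnn.
- by case: e_ok => -> -> -> ->.
- by move=> e; rewrite state_mem /chord !addbb; case: (e.2 == ycol p); case: (e.2 == ycol i).
by rewrite /chords_ok eqxx F.
Qed.

Lemma mixed_ext p j i p' j' i' :
  (forall t, t < period -> (t <= p) || (j < t <= i) = (t <= p') || (j' < t <= i')) ->
  (forall t, t < period -> (t < p) || (j <= t < i) = (t < p') || (j' <= t < i')) ->
  mixed p j i =i mixed p' j' i'.
Proof.
move=> hr hb e; case hc: (connect lk r0 e); last by rewrite !mixed_out ?hc.
by have [t tm [] ->] := connect_cases hc; [rewrite !mixed_old_edge // hr|rewrite !mixed_new_edge // hb].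
Qed.

Lemma mixed_step p j i e : p < j -> j <= i -> i < period ->
  (e \in mixed p j.-1 i) = (e \in mixed p j i) (+) (e == old_edge j) (+) (e == new_edge j.-1).
Proof.
move=> pj ji im; have jm := leq_ltn_trans ji im.
have jm' : j.-1 < period by apply: leq_ltn_trans jm; exact: leq_pred.
case hc: (connect lk r0 e); last first.
  rewrite !mixed_out ?hc //; have [ej|_] := eqVneq e (old_edge j); first by rewrite ej connect_old_edge in hc.
  have [ej|_] := eqVneq e (new_edge j.-1); first by rewrite ej connect_new_edge ?connect_old_edge in hc.
  by rewrite !addbF.
have [t tm [] ->] := connect_cases hc.
  rewrite !mixed_old_edge // old_edge_eq // [_ == new_edge _]eq_sym new_old_edge addbF.
  by have [->|ne] := eqVneq t j; rewrite ?addbT ?addbF; lia.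
rewrite !mixed_new_edge // new_old_edge new_edge_eq // addbF.
by have [->|ne] := eqVneq t j.-1; rewrite ?addbT ?addbF; lia.
Qed.

Lemma ycol_neq t : ycol t != ycol t.+1.
Proof. by apply: contraFneq (new_old_edge t t.+1) => eY; rewrite new_edgeE old_edgeE eY. Qed.

Lemma adjacent_state p j i : p < j -> j <= i -> i < period -> xrow j != xrow 0 ->
  (xrow 0, ycol j) \notin state p j i -> (xrow 0, ycol j.-1) \in state p j i ->
  switch_adj (state p j i) (state p j.-1 i).
Proof.
move=> pj ji im nx no1 i1; have jm := leq_ltn_trans ji im.
have jp : j.-1.+1 = j by rewrite prednK //; apply: leq_ltn_trans pj.
have jm' : j.-1 < period by apply: leq_ltn_trans jm; exact: leq_pred.
have blj : (xrow j, ycol j.-1) = new_edge j.-1 by rewrite new_edgeE jp.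
have ny : (ycol j == ycol j.-1) = false by rewrite -{1}jp eq_sym (negbTE (ycol_neq _)).
apply: (adjacent_intro (x := xrow j) _ i1 _ no1).
- by rewrite eq_sym.
- rewrite -old_edgeE state_mem old_edge_mem mixed_old_edge // /chord -/(xrow j) (negbTE nx) addbF; lia.
- rewrite blj state_mem new_edge_mem mixed_new_edge // -blj /chord (negbTE nx) addbF; lia.
move=> e; rewrite !state_mem mixed_step // -old_edgeE blj.
have cE : chord (xrow 0) (ycol p) (ycol i) (ycol j.-1) e =
  chord (xrow 0) (ycol p) (ycol i) (ycol j) e (+) (e == (xrow 0, ycol j)) (+) (e == (xrow 0, ycol j.-1)).
  case: e => u v; rewrite /chord !xpair_eqE /=; case: (u == _) => //=.
  by case: (v == ycol p); case: (v == ycol i); case: (v == ycol j); case: (v == ycol j.-1).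
rewrite cE; move: (e \in B1) (e \in mixed p j i) (chord _ _ _ _ _) (e == old_edge j) (e == new_edge _)
  (e == (xrow 0, ycol j)) (e == (xrow 0, ycol j.-1)).
by do 7!case.
Qed.

Definition filled p y := (xrow 0, y) \in state p p p.

(** Between two visits of the circuit to the pivot row, that row changes through the chords only. *)
Lemma state_row p j i y : p <= j <= i -> i < period -> (forall t, p < t <= i -> xrow t != xrow 0) ->
  ((xrow 0, y) \in state p j i) = filled p y (+) (y == ycol i) (+) (y == ycol j).
Proof.
move=> /andP[pj ji] im nx; rewrite /filled !state_mem.
have -> : ((xrow 0, y) \in mixed p j i) = ((xrow 0, y) \in mixed p p p).
  case hc: (connect lk r0 (xrow 0, y)); last by rewrite !mixed_out ?hc.
  have [t tm [] et] := connect_cases hc.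
    have : ~~ (p < t <= i) by apply: contraT => /negPn/nx; rewrite /xrow -et eqxx.
    by rewrite et !mixed_old_edge //; lia.
  have : ~~ (p < t.+1 <= i).
    by apply: contraT => /negPn/nx; have := new_edgeE t; rewrite -et => -[<- _]; rewrite eqxx.
  by rewrite et !mixed_new_edge //; lia.
rewrite /chord /= eqxx /=; case: (y == ycol p); case: (y == ycol i); case: (y == ycol j);
by case: (_ \in _); case: (_ \in _).
Qed.

Lemma state_diag p i : p <= i -> state p i i = state p p p.
Proof.
move=> pi; apply/setP=> e; rewrite !state_mem; congr (_ (+) _ (+) _).
  by apply: mixed_ext => t tm; lia.
by rewrite /chord -!addbA !addbb.
Qed.

Lemma state_end p i : p <= i -> state p p i = state i i i.
Proof.
move=> pi; apply/setP=> e; rewrite !state_mem; congr (_ (+) _ (+) _).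
  by apply: mixed_ext => t tm; lia.
rewrite /chord; case: (e.1 == _) => //=; by case: (e.2 == ycol p); case: (e.2 == ycol i).
Qed.

(** As [j] descends from [i] to [p], the hole is moved to columns that are full: they were full at
    the start, or they equal [ycol i], which is full while the hole is elsewhere. *)
Lemma phase_reach p i : p < i -> i < period -> (forall t, p < t <= i -> xrow t != xrow 0) ->
  filled p (ycol p) -> ~~ filled p (ycol i) ->
  (forall t, p <= t < i -> filled p (ycol t) || (ycol t == ycol i)) ->
  state p p p \in Bnd n d ->
  reach flow_step (i - p) (state p p p) (state i i i).
Proof.
move=> pi im nx Fp Fi Fm ZB.
suff key k : k <= i - p -> state p (i - k) i \in Bnd n d /\
    reach flow_step k (state p i i) (state p (i - k) i).
  have [_] := key (i - p) (leqnn _); rewrite subKn; last exact: ltnW.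
  by rewrite (state_diag (ltnW pi)) (state_end (ltnW pi)).
elim: k => [_|k IH kp]; first by rewrite subn0 (state_diag (ltnW pi)); split; [exact: ZB|exact: reach_refl].
have [ZkB rk] := IH (ltnW kp).
set j := i - k in ZkB rk.
have -> : i - k.+1 = j.-1 by rewrite subnS.
have pj : p < j by rewrite ltn_subRL addnC -ltn_subRL.
have ji : j <= i by exact: leq_subr.
clearbody j.
have jp : j.-1.+1 = j by rewrite prednK //; apply: leq_ltn_trans pj.
have pji : p <= j <= i by rewrite (ltnW pj).
have row y := state_row y pji im nx.
have nYpi : (ycol p == ycol i) = false by apply: contraNF Fi => /eqP <-.
have oj : (xrow 0, ycol j) \notin state p j i.
  rewrite row eqxx; move: ji; rewrite leq_eqVlt => /orP[/eqP ->|ji].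
    by rewrite eqxx (negbTE Fi).
  have := Fm j; rewrite (ltnW pj) ji => /(_ isT); case: eqP => [->|_]; first by rewrite (negbTE Fi).
  by rewrite orbF => ->.
have ij : (xrow 0, ycol j.-1) \in state p j i.
  have h : p <= j.-1 < i by rewrite -ltnS jp pj.
  have nYj : (ycol j.-1 == ycol j) = false by rewrite -{2}jp (negbTE (ycol_neq _)).
  rewrite row nYj addbF.
  have := Fm _ h; case: eqP => [->|_]; first by rewrite (negbTE Fi).
  by rewrite orbF => ->.
have adj : switch_adj (state p j i) (state p j.-1 i).
  apply: adjacent_state => //; apply: nx; by rewrite pj.
split; first exact: adjacent_Bnd adj.
rewrite -addn1; apply: reach_trans rk _; apply: reach_step; rewrite /flow_step ZkB adj /=.
apply/asboolP; move: ji; rewrite leq_eqVlt => /orP[/eqP ji|ji].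
  by rewrite ji; apply: (passes_start pi im); rewrite (state_diag (ltnW pi)).
apply: (passes_mid pj ji im); rewrite /chords_ok row (row (ycol p)) (negbTE Fi) Fp nYpi oj !eqxx /=.
rewrite ![_ == ycol j]eq_sym.
case jp': (ycol j == ycol p); case jip: (ycol j == ycol i) => //=.
by rewrite -(eqP jp') jip in nYpi.
Qed.

(** [e] ends the current excursion from the pivot row. The column of return must be empty, unless it
    is the one of the current chord, and an unfinished excursion must still meet an empty column for
    the next phase to aim at. *)
Definition invariant_at p := p < period /\ exists e, [/\ p <= e < period, xrow e.+1 = xrow 0,
  forall t, p < t <= e -> xrow t != xrow 0, filled p (ycol p) &
  (filled p (ycol e) -> ycol e = ycol p) /\ (p < e -> exists2 i, p < i <= e & ~~ filled p (ycol i))].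

(** The excursion returns through [new_edge e], an entry of the pivot row that is not yet inserted;
    so its column is empty. *)
Lemma invariant_start p : p < period -> xrow p = xrow 0 -> invariant_at p.
Proof.
move=> pm Xp; split=> //.
have exe : exists e, (p <= e) && (xrow e.+1 == xrow 0).
  exists period.-1; rewrite prednK ?period_gt0 // xrow_period eqxx andbT; lia.
case: (ex_minnP exe) => e /andP[pe /eqP Xe] emin.
have em : e < period.
  have := emin period.-1; rewrite prednK ?period_gt0 // xrow_period eqxx andbT; lia.
have nx t : p < t <= e -> xrow t != xrow 0.
  move=> ht; apply/eqP=> Xt; have := emin t.-1; rewrite prednK; last lia.
  rewrite Xt eqxx andbT; lia.
have Fe : ~~ filled p (ycol e).
  have ebl : (xrow 0, ycol e) = new_edge e by rewrite new_edgeE Xe.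
  rewrite /filled ebl state_mem new_edge_mem mixed_new_edge // -ebl /chord eqxx !addbb /=.
  have -> : (e < p) || (p <= e < p) = false by lia.
  apply: contraFN (new_old_edge e p) => /eqP /= eY; by rewrite new_edgeE old_edgeE Xe Xp eY.
exists e; split=> //; first by rewrite pe.
  by rewrite /filled -{1}Xp -old_edgeE state_mem old_edge_mem mixed_old_edge // leqnn /chord -/(xrow p) -/(ycol p) Xp !eqxx.
split=> [h|pe']; first by rewrite h in Fe.
by exists e => //; rewrite pe' leqnn.
Qed.

(** Both edges of this link are in the pivot row: the current chord is [new_edge p] itself and the
    next one is [old_edge p.+1], so the graph stays the same. *)
Lemma state_skip p : p.+1 < period -> xrow p.+1 = xrow 0 -> state p p p = state p.+1 p.+1 p.+1.
Proof.
move=> pm Xp; apply/setP=> e; rewrite !state_mem.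
have -> : (e \in mixed p.+1 p.+1 p.+1) = (e \in mixed p p p) (+) (e == old_edge p.+1) (+) (e == new_edge p).
  rewrite -[e \in mixed p p p](@mixed_ext p p.+1 p.+1); try by move=> t tm; lia.
  rewrite -(@mixed_ext p p p.+1); try by move=> t tm; lia.
  exact: (@mixed_step p p.+1 p.+1).
have -> : old_edge p.+1 = (xrow 0, ycol p.+1) by rewrite old_edgeE Xp.
have -> : new_edge p = (xrow 0, ycol p) by rewrite new_edgeE Xp.
case: e => u v; rewrite /chord !xpair_eqE !addbb /= -!addbA; congr (_ (+) (_ (+) _)).
by case: (u == _) => //=; case: (v == ycol p); case: (v == ycol p.+1).
Qed.

(* The next phase starts at the first empty column of the pivot row and ends at
   its last occurrence before another empty column: otherwise the walk could
   later return to that column, then full, with no empty column left. *)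
Lemma invariant_phase p e : p < e -> e < period -> xrow e.+1 = xrow 0 ->
  (forall t, p < t <= e -> xrow t != xrow 0) -> filled p (ycol p) ->
  (filled p (ycol e) -> ycol e = ycol p) -> (exists2 i, p < i <= e & ~~ filled p (ycol i)) ->
  exists i, [/\ p < i <= e, ~~ filled p (ycol i),
    forall t, p <= t < i -> filled p (ycol t) || (ycol t == ycol i) & invariant_at i].
Proof.
move=> pe em Xe nx Fp Fe [k /andP[pk ke] Fk].
have ex0 : exists i, (p < i) && ~~ filled p (ycol i) by exists k; rewrite pk.
case: (ex_minnP ex0) => i0 /andP[pi0 Fi0] min0.
have i0e : i0 <= e by apply: leq_trans ke; apply: min0; rewrite pk.
pose good i := [&& p < i <= e, ycol i == ycol i0 &
  all (fun t => filled p (ycol t) || (ycol t == ycol i0)) (iota p (i - p))].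
have ex1 : exists i, good i.
  exists i0; rewrite /good pi0 i0e eqxx /=; apply/allP=> t; rewrite mem_iota => ht.
  apply: contraT; rewrite negb_or => /andP[nF _].
  have pt : p < t.
    rewrite ltn_neqAle; apply/andP; split; last by lia.
    by apply: contraNneq nF => <-.
  have := min0 t; rewrite pt nF => /(_ isT); lia.
have bnd i : good i -> i <= e by case/and3P=> /andP[].
case: (ex_maxnP ex1 bnd) => i /and3P[/andP[pi ie] /eqP Yi /allP bet] maxi.
have Fi : ~~ filled p (ycol i) by rewrite Yi.
have btw t : p <= t < i -> filled p (ycol t) || (ycol t == ycol i).
  by move=> ht; rewrite Yi; apply: bet; rewrite mem_iota; lia.
have im : i < period by apply: leq_ltn_trans em.
have nxi t : p < t <= i -> xrow t != xrow 0 by move=> ht; apply: nx; lia.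
have Fi' y : filled i y = filled p y (+) (y == ycol i) (+) (y == ycol p).
  by rewrite {1}/filled -(state_end (ltnW pi)) state_row // leqnn (ltnW pi).
have nYpi : (ycol p == ycol i) = false by apply: contraNF Fi => /eqP <-.
exists i; split=> //; first by rewrite pi.
split=> //; exists e; split=> //.
- by rewrite ie.
- by move=> t ht; apply: nx; lia.
- by rewrite Fi' (negbTE Fi) eqxx eq_sym nYpi.
split.
  rewrite Fi'; case: (ycol e =P ycol i) => // _; case FYe: (filled p (ycol e)).
    by rewrite (Fe FYe) eqxx.
  by case: eqP => // Yep; rewrite Yep Fp in FYe.
move=> lie.
case: (pselect (exists2 t, i < t <= e & ~~ (filled p (ycol t) || (ycol t == ycol i)))) => [[t ht nt]|none].
  exists t => //; move: nt; rewrite Fi' negb_or => /andP[nF ni].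
  rewrite (negbTE nF) (negbTE ni) /=; by apply: contraNneq nF => ->.
(* By the maximality of [i], column [ycol e] was full at [p]; so it is [ycol p], which the phase has
   emptied, and [e] is the witness. *)
have all_t t : i < t <= e -> filled p (ycol t) || (ycol t == ycol i).
  by move=> ht; apply: contraT => nt; case: none; exists t.
have nYt t : i < t <= e -> ycol t != ycol i.
  move=> ht; apply/eqP=> Yt; have : t <= i; last by lia.
  apply: maxi; apply/and3P; split; [lia|by rewrite Yt Yi|].
  apply/allP=> u; rewrite mem_iota => hu; rewrite -Yi.
  case: (ltngtP u i) => [ui|ui|->]; last by rewrite eqxx orbT.
    apply: btw; lia.
  apply: all_t; lia.
have hee : i < e <= e by rewrite lie leqnn.
exists e => //; have := all_t _ hee; rewrite Fi' (negbTE (nYt _ hee)) orbF => FYe.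
by rewrite FYe (Fe FYe) eqxx.
Qed.

Lemma reach_Bnd k Z Z' : Z \in Bnd n d -> reach flow_step k Z Z' -> Z' \in Bnd n d.
Proof.
move=> ZB [p [pp <- _]]; elim: p Z ZB pp => //= Z1 p IH Z ZB /andP[/and3P[_ adj _] pp].
apply: IH pp; exact: adjacent_Bnd adj.
Qed.

Lemma circuit_tail p : state p p p \in Bnd n d -> invariant_at p ->
  reach flow_step (period.-1 - p) (state p p p) (state period.-1 period.-1 period.-1).
Proof.
have [N] := ubnP (period - p); elim: N p => // N IH p ltN ZB [pm [e [/andP[pe em] Xe nx Fp [Fe ex]]]].
move: pe; rewrite leq_eqVlt => /orP[/eqP pe|pe].
  subst e; have [pm1|pm1] := leqP period p.+1.
    by have -> : period.-1 = p by [lia|]; rewrite subnn; exact: reach_refl.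
  rewrite state_skip //; apply: reach_leq (IH p.+1 _ _ _); [lia|lia| |].
    by rewrite -state_skip.
  exact: invariant_start.
have [i [/andP[pi ie] Fi btw inv]] := invariant_phase pe em Xe nx Fp Fe (ex pe).
have im : i < period by apply: leq_ltn_trans em.
have ph : reach flow_step (i - p) (state p p p) (state i i i).
  by apply: phase_reach => // t ht; apply: nx; lia.
apply: reach_leq (reach_trans ph (IH i _ _ inv)); [lia|lia|].
exact: reach_Bnd ph.
Qed.

Lemma state_first : state 0 0 0 = stage (rnk r0).
Proof.
apply/setP=> e; rewrite state_mem stage_mem -addbA; congr (_ (+) _).
have cE : chord (xrow 0) (ycol 0) (ycol 0) (ycol 0) e = (e == old_edge 0).
  by case: e => u v; rewrite old_edgeE xpair_eqE /chord !addbb.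
rewrite cE; case hc: (connect lk r0 e); last first.
  rewrite mixed_out ?hc //; have [er|_] := eqVneq e (old_edge 0); last by rewrite addbF.
  by rewrite er connect0 in hc.
rewrite (root_connect_r0 hc) ltnn andbF.
have [t tm [] ->] := connect_cases hc.
  by rewrite mixed_old_edge // old_edge_eq ?period_gt0 // leqn0; case: t {tm}.
by rewrite mixed_new_edge // new_old_edge; case: t {tm}.
Qed.

Lemma state_last : state period.-1 period.-1 period.-1 = stage (rnk r0).+1.
Proof.
have m1 : period.-1 < period by rewrite prednK ?period_gt0.
apply/setP=> e; rewrite state_mem stage_mem -addbA; congr (_ (+) _).
have cE : chord (xrow 0) (ycol period.-1) (ycol period.-1) (ycol period.-1) e = (e == new_edge period.-1).
  by case: e => u v; rewrite new_edgeE prednK ?period_gt0 // xrow_period xpair_eqE /chord !addbb.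
rewrite cE; case hc: (connect lk r0 e); last first.
  rewrite mixed_out ?hc //; have [er|_] := eqVneq e (new_edge period.-1).
    by rewrite er connect_new_edge ?connect_old_edge in hc.
  rewrite addbF ltnS [in RHS]leq_eqVlt; congr (_ && _).
  suff -> : (rnk e == rnk r0) = false by [].
  apply: contraFF hc => /eqP/ord_inj/enum_rank_inj h.
  by rewrite -(root_connect link_sym) h.
rewrite (root_connect_r0 hc) ltnSn andbT.
have [t tm [] ->] := connect_cases hc.
  rewrite mixed_old_edge // [old_edge t == _]eq_sym new_old_edge old_edge_mem old_edge_mem /=; lia.
rewrite mixed_new_edge // new_edge_eq // new_edge_mem new_edge_mem /=.
by have [->|ne] := eqVneq t period.-1; rewrite ?addbT ?addbF; lia.
Qed.

Lemma circuit_reach : stage (rnk r0) \in Bnd n d ->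
  reach flow_step period (stage (rnk r0)) (stage (rnk r0).+1).
Proof.
rewrite -state_first -state_last => ZB.
apply: reach_leq (circuit_tail ZB _); first by lia.
by apply: invariant_start; rewrite ?period_gt0.
Qed.

(** The switches of a circuit are charged to its own edges, so the lengths of all circuits add up to
    at most [#|B1| = n * d]. *)
Lemma circuit_size : period <= #|[set e in B1 :\: B2 | rnk e == rnk r0]|.
Proof.
have ri : injective (fun t : 'I_period => old_edge t).
  by move=> t u /eqP; rewrite old_edge_eq // => /eqP/ord_inj.
rewrite -[period]card_ord -cardsT -(card_imset _ ri); apply: subset_leq_card.
by apply/subsetP=> e /imsetP[t _ ->]; rewrite inE old_edge_in (root_connect_r0 (connect_old_edge t)) eqxx.
Qed.

End Fixed.

Lemma stage_reach k : k <= #|{: V}| -> stage k \in Bnd n d /\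
  reach flow_step #|[set e in B1 :\: B2 | rnk e < k]| B1 (stage k).
Proof.
elim: k => [_|k IH kV].
  have -> : stage 0 = B1 by apply/setP=> e; rewrite !inE andbF addbF.
  split; first exact: B1B.
  apply: reach_leq (reach_refl _ 0 _); exact: leq0n.
have [ZB rch] := IH (ltnW kV).
have split_card : #|[set e in B1 :\: B2 | rnk e < k.+1]| =
   #|[set e in B1 :\: B2 | rnk e < k]| + #|[set e in B1 :\: B2 | rnk e == k]|.
  rewrite -cardsUI [W in _ + #|pred_of_set W|](_ : _ = set0) ?cards0 ?addn0.
    by congr #|pred_of_set _|; apply/setP=> e; rewrite !inE ltnS leq_eqVlt orbC -andb_orr.
  by apply/setP=> e; rewrite !inE; case: ltngtP; rewrite ?andbF.
have [none|[e]] := set_0Vmem [set e | H e && (rnk e == k)].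
  have -> : stage k.+1 = stage k.
    apply/setP=> e; rewrite !inE ltnS [rnk e <= k]leq_eqVlt andb_orr.
    by have := in_set0 e; rewrite -none inE => ->.
  split; first exact: ZB.
  apply: reach_leq rch; by rewrite split_card leq_addr.
rewrite inE => /andP[He /eqP re].
have [r0 r0R rr] : exists2 r0, r0 \in B1 :\: B2 & rnk r0 = k.
  case e1: (e \in B1); first by exists e; rewrite // inE e1 andbT; move: He; rewrite e1; case: (_ \in B2).
  exists (a e); last by rewrite root_a.
  by rewrite (pairing_memD _ Ha).1 inE e1; move: He; rewrite e1; case: (_ \in B2).
have cr : reach flow_step (period r0) (stage k) (stage k.+1).
  by rewrite -rr; apply: circuit_reach; rewrite ?rr.
split; first exact: reach_Bnd cr.
apply: reach_leq (reach_trans rch cr); rewrite split_card leq_add2l -rr; exact: circuit_size.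
Qed.

Theorem flow_reach : reach flow_step (n * d) B1 B2.
Proof.
have [_ rch] := stage_reach (leqnn _).
have eS : stage #|{: V}| = B2.
  apply/setP=> e; rewrite !inE ltn_ord andbT; by case: (e \in B1); case: (e \in B2).
rewrite eS in rch; apply: reach_leq rch; rewrite -(card_Bnd B1B).
by apply: subset_leq_card; apply/subsetP=> e; rewrite !inE => /andP[/andP[]].
Qed.

End Circuit.

(** * Lazy symmetric chains *)

Import Order.TTheory GRing.Theory Num.Theory.
Local Open Scope ring_scope.

Section Chain.
Variables (R : realFieldType) (I : finType) (S : {set I}) (P : I -> I -> R) (A : R).
Implicit Types (f g q : I -> R).

Lemma sqr_mean q f : (forall x, x \in S -> 0 <= q x) -> \sum_(x in S) q x = 1 ->
  (\sum_(x in S) q x * f x) ^+ 2 <= \sum_(x in S) q x * f x ^+ 2.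
Proof.
move=> q0 q1; set M := \sum_(x in S) q x * f x.
have ME : \sum_(x in S) q x * f x = M by [].
clearbody M.
have : 0 <= \sum_(x in S) q x * (f x - M) ^+ 2.
  by apply: sumr_ge0 => x /q0 h; rewrite mulr_ge0 ?sqr_ge0.
have -> : \sum_(x in S) q x * (f x - M) ^+ 2 =
    \sum_(x in S) q x * f x ^+ 2 - 2 * M * (\sum_(x in S) q x * f x) + M ^+ 2 * (\sum_(x in S) q x).
  rewrite !mulr_sumr -sumrB -big_split /=.
  by apply: eq_bigr => x _; ring.
by rewrite q1 ME => h; nra.
Qed.

Lemma sqr_sum_norm f : (\sum_(x in S) `|f x|) ^+ 2 <= #|S|%:R * \sum_(x in S) f x ^+ 2.
Proof.
have [S0|] := posnP #|S|.
  by rewrite (cards0_eq S0) !big_set0 expr0n mulr0.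
rewrite -(ltr0n R) => S0; have S0' := lt0r_neq0 S0.
have N1 : \sum_(x in S) #|S|%:R^-1 = 1 :> R by rewrite sumr_const -[_ *+ _]mulr_natl mulfV.
have Nge0 x : x \in S -> 0 <= #|S|%:R^-1 :> R by rewrite invr_ge0 ltW.
have h := sqr_mean (fun x => `|f x|) Nge0 N1.
move: h; rewrite -!mulr_sumr exprMn.
under [in X in _ <= X -> _]eq_bigr => x _ do rewrite real_normK ?num_real //.
rewrite expr2 -mulrA ler_pM2l ?invr_gt0 // => h.
by rewrite -ler_pdivrMl.
Qed.

Hypothesis P_ge0 : forall x y, x \in S -> y \in S -> 0 <= P x y.
Hypothesis P_sym : forall x y, x \in S -> y \in S -> P x y = P y x.
Hypothesis P_sum : forall x, x \in S -> \sum_(y in S) P x y = 1.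
Hypothesis P_lazy : forall x, x \in S -> 2^-1 <= P x x.
Hypothesis A_gt0 : 0 < A.
Hypothesis poincare : forall f,
  \sum_(x in S) \sum_(y in S) (f x - f y) ^+ 2 <=
  A * #|S|%:R * \sum_(x in S) \sum_(y in S) P x y * (f x - f y) ^+ 2.

Definition push f x := \sum_(y in S) f y * P y x.

Lemma sum_push f : \sum_(x in S) push f x = \sum_(x in S) f x.
Proof.
rewrite /push exchange_big /=; apply: eq_bigr => y yS.
by rewrite -mulr_sumr P_sum // mulr1.
Qed.

(* With [P = (1 + Q) / 2] this says [|Q f| <= |f|], and [Q] is stochastic. *)
Lemma push_sqr f : \sum_(x in S) push f x ^+ 2 <= \sum_(x in S) f x * push f x.
Proof.
pose Q x y := 2 * P x y - (x == y)%:R.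
have Q0 x y : x \in S -> y \in S -> 0 <= Q x y.
  move=> xS yS; rewrite /Q; case: eqP => [<-|_] /=.
    by have := P_lazy xS; rewrite mulr1n; lra.
  by have := P_ge0 xS yS; rewrite mulr0n; lra.
have delta (g : I -> R) x : x \in S -> \sum_(y in S) (x == y)%:R * g y = g x.
  move=> xS; rewrite (bigD1 x) //= eqxx mul1r big1 ?addr0 // => y /andP[_ ne].
  by rewrite eq_sym (negbTE ne) mul0r.
have Q1 x : x \in S -> \sum_(y in S) Q x y = 1.
  move=> xS; rewrite sumrB -mulr_sumr P_sum //.
  have := delta (fun=> 1) x xS; under eq_bigr => y _ do rewrite mulr1.
  by move=> ->; lra.
have QE x : x \in S -> \sum_(y in S) Q x y * f y = 2 * push f x - f x.
  move=> xS; rewrite /push mulr_sumr -(delta f x xS) -sumrB; apply: eq_bigr => y yS.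
  by rewrite /Q (P_sym xS yS); ring.
have : \sum_(x in S) (2 * push f x - f x) ^+ 2 <= \sum_(x in S) f x ^+ 2.
  apply: (@le_trans _ _ (\sum_(x in S) \sum_(y in S) Q x y * f y ^+ 2)).
    apply: ler_sum => x xS; rewrite -QE //; apply: sqr_mean; last exact: Q1.
    by move=> y; apply: Q0.
  rewrite exchange_big /=; apply: ler_sum => y yS.
  rewrite -mulr_suml (_ : \sum_(x in S) Q x y = 1) ?mul1r //.
  rewrite -(Q1 y yS); apply: eq_bigr => x xS.
  by rewrite /Q (P_sym xS yS) eq_sym.
have -> : \sum_(x in S) (2 * push f x - f x) ^+ 2 =
  4 * \sum_(x in S) push f x ^+ 2 - 4 * (\sum_(x in S) f x * push f x) + \sum_(x in S) f x ^+ 2.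
  rewrite !mulr_sumr -sumrB -big_split /=; apply: eq_bigr => x _; ring.
by lra.
Qed.

(** For mean zero the Poincare inequality reads [2 |S| F <= 2 A |S| (F - G)], that is
    [G <= (1 - 1 / A) F], and [push_sqr] bounds the left side by [G]. *)
Lemma push_contract f : \sum_(x in S) f x = 0 ->
  \sum_(x in S) push f x ^+ 2 <= (1 - A^-1) * \sum_(x in S) f x ^+ 2.
Proof.
move=> f0; apply: le_trans (push_sqr f) _.
have [S0|] := posnP #|S|; first by rewrite (cards0_eq S0) !big_set0 mulr0.
rewrite -(ltr0n R) => S0.
set F := \sum_(x in S) f x ^+ 2; set G := \sum_(x in S) f x * push f x.
have EV : \sum_(x in S) \sum_(y in S) (f x - f y) ^+ 2 = 2 * #|S|%:R * F.
  have -> : \sum_(x in S) \sum_(y in S) (f x - f y) ^+ 2 =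
    \sum_(x in S) (#|S|%:R * f x ^+ 2 + (F - 2 * f x * \sum_(y in S) f y)).
    apply: eq_bigr => x _; rewrite mulr_sumr -sumrB.
    rewrite mulr_natl -sumr_const -big_split /=.
    by apply: eq_bigr => y _; ring.
  rewrite f0; under eq_bigr => x _ do rewrite mulr0 subr0.
  rewrite big_split /= -mulr_sumr sumr_const -[F *+ _]mulr_natl -/F; ring.
have EP : \sum_(x in S) \sum_(y in S) P x y * (f x - f y) ^+ 2 = 2 * (F - G).
  have -> : \sum_(x in S) \sum_(y in S) P x y * (f x - f y) ^+ 2 =
    \sum_(x in S) (f x ^+ 2 - 2 * (f x * push f x) + push (fun y => f y ^+ 2) x).
    apply: eq_bigr => x xS.
    have -> : f x ^+ 2 = \sum_(y in S) P x y * f x ^+ 2 by rewrite -mulr_suml P_sum ?mul1r.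
    rewrite /push !mulr_sumr -sumrB -big_split /=; apply: eq_bigr => y yS.
    by rewrite (P_sym yS xS); ring.
  rewrite big_split /= sumrB -mulr_sumr sum_push -/F -/G; ring.
have := poincare f; rewrite EV EP => h.
have {}h : F <= A * (F - G).
  rewrite -(ler_pM2l (_ : 0 < 2 * #|S|%:R)); last by rewrite mulr_gt0.
  apply: le_trans h _; rewrite le_eqVlt; apply/orP; left; apply/eqP; ring.
rewrite mulrBl mul1r lerBrDr addrC -lerBrDr.
by rewrite ler_pdivrMl.
Qed.

Lemma iter_contract (mu : nat -> I -> R) :
  (forall t x, x \in S -> mu t.+1 x = push (mu t) x) ->
  \sum_(x in S) mu 0 x = 1 -> \sum_(x in S) mu 0 x ^+ 2 <= 1 -> A^-1 <= 1 -> (0 < #|S|)%N ->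
  forall t, (\sum_(x in S) `|mu t x - #|S|%:R^-1|) ^+ 2 <= #|S|%:R * (1 - A^-1) ^+ t.
Proof.
move=> muS mu1 mu2 A1; rewrite -(ltr0n R) => S0.
set N := #|S|%:R in S0 *; have N0 := lt0r_neq0 S0.
have sum_const : \sum_(x in S) N^-1 = 1 by rewrite sumr_const -mulr_natl mulfV.
pose h t x := mu t x - N^-1.
have mu1t t : \sum_(x in S) mu t x = 1.
  by elim: t => // t IH; rewrite -IH -(sum_push (mu t)); apply: eq_bigr => x /muS.
have h0 t : \sum_(x in S) h t x = 0 by rewrite sumrB mu1t sum_const subrr.
have hS t x : x \in S -> h t.+1 x = push (h t) x.
  move=> xS; rewrite /h muS // /push.
  under [RHS]eq_bigr => y _ do rewrite mulrBl.
  rewrite sumrB -mulr_sumr; congr (_ - _); rewrite -[LHS]mulr1; congr (_ * _).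
  by rewrite -(P_sum xS); apply: eq_bigr => y yS; rewrite P_sym.
have key t : \sum_(x in S) h t x ^+ 2 <= (1 - A^-1) ^+ t.
  elim: t => [|t IH]; last first.
    under eq_bigr => x xS do rewrite hS //.
    apply: le_trans (push_contract (h0 t)) _.
    by rewrite exprS ler_wpM2l // subr_ge0.
  rewrite expr0; apply: le_trans mu2.
  (* Both sums in the bracket are 1, so centering lowers the sum of squares by [N^-1]. *)
  have -> : \sum_(x in S) h 0 x ^+ 2 = \sum_(x in S) mu 0 x ^+ 2 - N^-1 * (2 * \sum_(x in S) mu 0 x - \sum_(x in S) N^-1).
    rewrite mulr_sumr -sumrB mulr_sumr -sumrB; apply: eq_bigr => x _; rewrite /h; ring.
  rewrite mu1 sum_const lerBlDr lerDl mulr_ge0 ?invr_ge0 ?ltW //; lra.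
move=> t; apply: le_trans (sqr_sum_norm (h t)) _.
by apply: ler_wpM2l; [exact: ltW|exact: key].
Qed.
End Chain.

(** * The switch chain *)

Section Energy.
Variables (R : realFieldType) (T : finType) (e : rel T).

(** The walk is shortened to one without repeated vertices, so that no step counts twice; then
    Cauchy-Schwarz applies to the telescoping sum. *)
Lemma reach_energy k x y (f : T -> R) : reach e k x y ->
  (f x - f y) ^+ 2 <= k%:R * \sum_z \sum_u (e z u)%:R * (f z - f u) ^+ 2.
Proof.
case=> p0 [pp0 <- sp0]; case: (shortenP pp0) => p pp up sub {pp0}.
have sp : (size p <= k)%N.
  apply: leq_trans sp0; apply: uniq_leq_size sub; by case/andP: up.
pose g (q : T * T) := f q.1 - f q.2.
pose ps := zip (belast x p) p.
have sz : size (belast x p) = size p by rewrite size_belast.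
have ups : uniq ps.
  apply: (@map_uniq _ _ fst); rewrite -/unzip1 unzip1_zip ?sz //.
  by move: up; rewrite lastI rcons_uniq => /andP[].
have tele : f x - f (last x p) = \sum_(q <- ps) g q.
  rewrite /ps; elim: p x {pp up sp sz ups sub ps} => [|z p IH] x /=.
    by rewrite big_nil subrr.
  by rewrite big_cons -IH /g /= addrA subrK.
have eps q : q \in ps -> e q.1 q.2.
  rewrite /ps; elim: p x pp {up sp sz ups sub ps tele} => [|z p IH] x //= /andP[exz pp].
  by rewrite inE => /orP[/eqP->//|]; apply: IH.
pose S := [set q in ps].
have sumS (h : T * T -> R) : \sum_(q <- ps) h q = \sum_(q in S) h q.
  by rewrite big_uniq //=; apply: eq_bigl => q; rewrite inE.
have cS : (#|S| <= k)%N.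
  rewrite cardsE; apply: leq_trans (card_size _) _.
  by rewrite size_zip sz minnn.
rewrite tele sumS -[_ ^+ 2]real_normK ?num_real //.
apply: (@le_trans _ _ ((\sum_(q in S) `|g q|) ^+ 2)).
  by rewrite ler_sqr ?nnegrE ?normr_ge0 ?sumr_ge0 ?ler_norm_sum.
apply: le_trans (sqr_sum_norm _ _) _.
apply: ler_pM; rewrite ?ler_nat ?ler0n ?sumr_ge0 //; first by move=> q _; exact: sqr_ge0.
rewrite pair_big /= big_mkcond; apply: ler_sum => -[z u] _.
rewrite inE; case: ifP => [/eps /= ->|_]; first by rewrite mul1r.
by rewrite mulr_ge0 ?ler0n ?sqr_ge0.
Qed.
End Energy.

(** * Transition probabilities and the Poincare inequality *)

Section SwitchChain.
Variables (R : realType) (n d : nat).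
Notation V := ('I_n * 'I_n)%type.
Implicit Types (B Z : bgraph n).
Local Notation P := (@switchP R n).

Lemma switch_id B e1 e2 : e1 \in B -> e2 \in B -> ~~ switchable B e1 e2 ->
  switch B e1 e2 = B.
Proof.
rewrite /switch /switchable => -> -> /=; by case: ifP.
Qed.

Lemma switch_Bnd B e1 e2 : B \in Bnd n d -> e1 \in B -> e2 \in B -> switch B e1 e2 \in Bnd n d.
Proof.
move=> BB i1 i2; case sw: (switchable B e1 e2); last by rewrite switch_id ?sw.
by apply: (adjacent_Bnd BB); apply/existsP; exists e1; apply/existsP; exists e2; rewrite sw eqxx.
Qed.

Lemma switchC B e1 e2 : switch B e1 e2 = switch B e2 e1.
Proof.
rewrite /switch [e1.1 == _]eq_sym [e1.2 == _]eq_sym.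
case: (e2.1 == _) => //=; case: (e2.2 == _) => //=; rewrite andbC; case: ifP => // _.
apply/setP=> e; rewrite !inE orbC [RHS]orbC; congr (_ || _); first exact: orbC.
by rewrite andbCA.
Qed.

Definition cross (p : V * V) : V * V := ((p.1.1, p.2.2), (p.2.1, p.1.2)).

Lemma crossK : involutive cross.
Proof. by case=> [[x1 y1] [x2 y2]]. Qed.

Lemma switch_back B p : switchable B p.1 p.2 ->
  switchable (switch B p.1 p.2) (cross p).1 (cross p).2 /\
  switch (switch B p.1 p.2) (cross p).1 (cross p).2 = B.
Proof.
case: p => [[x1 y1] [x2 y2]] /= sw; have mem e := switch_mem e sw.
move: (sw) => /and5P[] /= i1 i2 nx ny /andP[no1 no2].
have sw' : switchable (switch B (x1, y1) (x2, y2)) (x1, y2) (x2, y1).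
  rewrite /switchable /= nx eq_sym ny.
  have := mem (x1, y2); have := mem (x2, y1); have := mem (x1, y1); have := mem (x2, y2).
  rewrite /= i1 i2 (negbTE no1) (negbTE no2) !xpair_eqE !eqxx.
  rewrite ![x2 == x1]eq_sym ![y2 == y1]eq_sym (negbTE nx) (negbTE ny) /= !addn0.
  by do 4!case: (_ \in _).
split=> //; apply/setP=> e; have := switch_mem e sw'; have := mem e; rewrite /=.
move: (_ \in switch B _ _) (_ \in switch (switch _ _ _) _ _) (e \in B)
  ((x1, y1) == e) ((x2, y2) == e) ((x1, y2) == e) ((x2, y1) == e).
by do 7!case.
Qed.

Definition moves B B' := [set p in edge_pairs B | switch B p.1 p.2 == B'].

(** [cross] sends a move injectively to one that undoes it. *)
Lemma card_moves_le B B' : B != B' -> (#|moves B B'| <= #|moves B' B|)%N.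
Proof.
move=> ne; rewrite -(card_imset _ (inv_inj crossK)); apply: subset_leq_card.
apply/subsetP=> q /imsetP[p]; rewrite !inE => /andP[/and3P[i1 i2 _] /eqP sB] ->.
have sw : switchable B p.1 p.2.
  by apply: contraNT ne => nsw; rewrite -sB switch_id.
have [sw' sw2] := switch_back sw; rewrite sB in sw' sw2.
have /and5P[j1 j2 nx ny _] := sw'.
rewrite j1 j2 sw2 eqxx andbT /=; by apply: contraNneq nx => -[h _]; rewrite /= h.
Qed.

Lemma card_moves B B' : B != B' -> #|moves B B'| = #|moves B' B|.
Proof. by move=> ne; apply/eqP; rewrite eqn_leq !card_moves_le // eq_sym. Qed.

Lemma card_edge_pairs B : #|edge_pairs B| = (#|B| * #|B| - #|B|)%N.
Proof.
rewrite -cardsX; have di : injective (fun e : V => (e, e)) by move=> e f [].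
rewrite -[X in (_ - X)%N](card_imset _ di).
have sub : [set (e, e) | e in B] \subset setX B B.
  by apply/subsetP=> q /imsetP[e eB ->]; rewrite inE /= eB.
rewrite -(setIidPr sub) -cardsD; apply: eq_card => -[e f]; rewrite !inE /=.
case eB: (e \in B); case fB: (f \in B); rewrite ?andbF ?andbT //=.
by congr (~~ _); apply/eqP/imsetP => [->|[g _ [-> ->]]] //; exists f.
Qed.

Lemma switchP_ge0 B B' : 0 <= P B B'.
Proof.
rewrite /switchP; case: ifP => _; first exact: ler0n.
by rewrite addr_ge0 // mulr_ge0 ?invr_ge0 ?ler0n ?mulr_ge0 ?invr_ge0 ?ler0n.
Qed.

Lemma switchP_lazy B : 2^-1 <= P B B.
Proof.
rewrite /switchP eqxx; case: ifP => _; first by rewrite /=; lra.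
by rewrite mulr1 lerDl mulr_ge0 ?invr_ge0 ?ler0n ?mulr_ge0 ?invr_ge0 ?ler0n.
Qed.

Lemma switchP_sym B B' : B \in Bnd n d -> B' \in Bnd n d -> P B B' = P B' B.
Proof.
move=> BB BB'; have [->//|ne] := eqVneq B B'.
have cE : #|edge_pairs B| = #|edge_pairs B'|.
  by rewrite !card_edge_pairs (card_Bnd BB) (card_Bnd BB').
by rewrite /switchP cE [B == B']eq_sym -/(moves B B') -/(moves B' B) (card_moves ne).
Qed.

Lemma switchP_out B B' : B \in Bnd n d -> B' \notin Bnd n d -> P B B' = 0.
Proof.
move=> BB nB; have ne : (B == B') = false by apply: contraNF nB => /eqP <-.
rewrite /switchP ne; case: ifP => // _; rewrite mulr0 add0r -/(moves B B').
have -> : moves B B' = set0; last by rewrite cards0 !(mul0r, mulr0).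
apply/setP=> p; rewrite !inE; apply: contraNF nB => /andP[/and3P[i1 i2 _] /eqP <-].
exact: switch_Bnd.
Qed.

Lemma switchP_sum B : B \in Bnd n d -> \sum_(B' in Bnd n d) P B B' = 1.
Proof.
move=> BB.
have one : \sum_(B' in Bnd n d) ((B == B') : nat)%:R = 1 :> R.
  rewrite (bigD1 B) //= eqxx big1 ?addr0 // => B' /andP[_ ne].
  by rewrite eq_sym (negbTE ne).
rewrite /switchP; case: eqP => [_|/eqP E0]; first exact: one.
rewrite big_split /= -!mulr_sumr one -mulr_suml -natr_sum.
have -> : (\sum_(B' in Bnd n d) #|[set p in edge_pairs B | switch B p.1 p.2 == B']|)%N
   = #|edge_pairs B|.
  rewrite -sum1_card (partition_big (fun p => switch B p.1 p.2) (mem (Bnd n d))) /=.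
    by apply: eq_bigr => B' _; rewrite -sum1_card; apply: eq_bigl => p; rewrite inE.
  by move=> p; rewrite inE => /and3P[i1 i2 _]; apply: switch_Bnd.
by rewrite divff ?pnatr_eq0 //; lra.
Qed.

(** Both orders of the two chosen edges give the switch, and this factor 2 cancels the laziness. *)
Lemma adjacent_switchP Z Z' : Z \in Bnd n d -> switch_adj Z Z' ->
  1 <= (n%:R * d%:R) ^+ 2 * P Z Z' :> R.
Proof.
move=> ZB /existsP[e1 /existsP[e2 /andP[sw /eqP eZ]]].
have /and5P[i1 i2 nx ny /andP[no1 no2]] := sw.
have ne : (Z == Z') = false.
  have new : (e1.1, e2.2) \in Z' by rewrite eZ /switch nx ny no1 no2 /= !inE eqxx orbT.
  by apply: contraNF (no1) => /eqP ->.
have n12 : e1 != e2 by apply: contraNneq nx => ->.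
have mv : [set (e1, e2); (e2, e1)] \subset moves Z Z'.
  apply/subsetP=> p; rewrite !inE => /orP[] /eqP-> /=; rewrite i1 i2 ?(eq_sym e2) n12 eZ ?eqxx //=.
  by rewrite switchC.
have c2 : (2 <= #|moves Z Z'|)%N.
  apply: leq_trans (subset_leq_card mv); rewrite cards2 xpair_eqE.
  by rewrite (negbTE n12).
have pos : (0 < #|edge_pairs Z|)%N.
  apply/card_gt0P; exists (e1, e2); by rewrite inE i1 i2.
have le : (#|edge_pairs Z| <= (n * d) ^ 2)%N.
  by rewrite card_edge_pairs (card_Bnd ZB) expnS expn1 leq_subr.
rewrite /switchP ne mulr0 add0r -/(moves Z Z') (gtn_eqF pos).
rewrite -natrM -natrX mulrA mulrA ler_pdivlMr ?ltr0n // mul1r.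
have h1 : #|edge_pairs Z|%:R <= ((n * d) ^ 2)%:R :> R by rewrite ler_nat.
have h2 : 2 <= #|moves Z Z'|%:R :> R by rewrite ler_nat.
have h3 : 0 <= ((n * d) ^ 2)%:R :> R by rewrite ler0n.
by nra.
Qed.

Hypotheses (n_gt0 : (0 < n)%N) (d_gt0 : (0 < d)%N).
(** The product of the congestion [16 n^3 d^12], the path length [n d] and the inverse transition
    probability [(n d)^2]. *)
Let A : R := 16 * n%:R ^+ 6 * d%:R ^+ 15.

Lemma switch_poincare (f : bgraph n -> R) :
  \sum_(B in Bnd n d) \sum_(B' in Bnd n d) (f B - f B') ^+ 2 <=
  A * #|Bnd n d|%:R * \sum_(B in Bnd n d) \sum_(B' in Bnd n d) P B B' * (f B - f B') ^+ 2.
Proof.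
pose Tt : finType := ({perm V} * {perm V})%type.
pose T2 : R := #|{: Tt}|%:R.
have T2_gt0 : 0 < T2 by rewrite ltr0n; apply/card_gt0P; exists (1%g, 1%g).
have T2E x : T2 * x = \sum_(t : Tt) x by rewrite sumr_const -mulr_natl.
set NB := #|Bnd n d|.
(* This counts the triples whose relation allows the step, an upper bound for the number of paths
   that use it. *)
pose cnt Z Z' := \sum_(B in Bnd n d) \sum_(B' in Bnd n d) \sum_(t : Tt)
   (@flow_step n d ((B, B'), t) Z Z')%:R : R.
have cnt_le Z Z' : cnt Z Z' * (f Z - f Z') ^+ 2 <=
   if (Z \in Bnd n d) && (Z' \in Bnd n d)
   then 16 * n%:R ^+ 3 * d%:R ^+ 12 * (NB%:R * T2) * ((n%:R * d%:R) ^+ 2 * P Z Z' * (f Z - f Z') ^+ 2)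
   else 0.
  have cnt0 : ~~ [&& Z \in Bnd n d & switch_adj Z Z'] -> cnt Z Z' = 0.
    move=> h; rewrite /cnt !big1 // => B _; rewrite big1 // => B' _; rewrite big1 // => t _.
    by rewrite /flow_step andbA (negbTE h).
  have [/andP[ZB adj]|h] := boolP [&& Z \in Bnd n d & switch_adj Z Z']; last first.
    rewrite cnt0 // mul0r; case: ifP => // _.
    apply: mulr_ge0; first by rewrite !mulr_ge0 ?exprn_ge0 ?ler0n ?ltW.
    by apply: mulr_ge0; [apply: mulr_ge0; [exact: sqr_ge0|exact: switchP_ge0]|exact: sqr_ge0].
  rewrite ZB (adjacent_Bnd ZB adj) /=.
  have cntE : cnt Z Z' = #|[set w : (bgraph n * bgraph n) * Tt |
      [&& w.1.1 \in Bnd n d, w.1.2 \in Bnd n d & @flow_step n d w Z Z']]|%:R.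
    rewrite /cnt -sum1_card natr_sum pair_big /= pair_big /= big_mkcond [RHS]big_mkcond /=.
    by apply: eq_bigr => -[[B B'] t] _; rewrite [in RHS]in_set /= andbT; do 2!case: (_ \in Bnd n d); case: (@flow_step n d ((B, B'), t) Z Z').
  have le : cnt Z Z' <= 16 * n%:R ^+ 3 * d%:R ^+ 12 * (NB%:R * T2).
    rewrite cntE /T2 -!natrX -!natrM ler_nat card_prod.
    apply: leq_trans (card_passes d_gt0 ZB); apply: subset_leq_card.
    apply/subsetP=> w; rewrite !inE => /and3P[h1 h2 /and3P[_ _ /asboolP h3]]; exact/asboolP.
  apply: (@le_trans _ _ (16 * n%:R ^+ 3 * d%:R ^+ 12 * (NB%:R * T2) * (f Z - f Z') ^+ 2)).
    by rewrite ler_wpM2r ?sqr_ge0.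
  apply: ler_wpM2l; first by rewrite !mulr_ge0 ?exprn_ge0 ?ler0n ?ltW.
  rewrite -[leLHS]mul1r ler_wpM2r ?sqr_ge0 //; exact: adjacent_switchP.
rewrite -(ler_pM2l T2_gt0).
apply: (@le_trans _ _ ((n * d)%:R * \sum_Z \sum_Z' cnt Z Z' * (f Z - f Z') ^+ 2)).
  have -> : \sum_Z \sum_Z' cnt Z Z' * (f Z - f Z') ^+ 2 =
    \sum_(B in Bnd n d) \sum_(B' in Bnd n d) \sum_(t : Tt) \sum_Z \sum_Z'
      (@flow_step n d ((B, B'), t) Z Z')%:R * (f Z - f Z') ^+ 2.
    rewrite (eq_bigr (fun Z => \sum_(B in Bnd n d) \sum_(B' in Bnd n d) \sum_(t : Tt) \sum_Z'
      (@flow_step n d ((B, B'), t) Z Z')%:R * (f Z - f Z') ^+ 2)) => [|Z _].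
      rewrite exchange_big /=; apply: eq_bigr => B _.
      rewrite exchange_big /=; apply: eq_bigr => B' _; exact: exchange_big.
    rewrite (eq_bigr (fun Z' => \sum_(B in Bnd n d) \sum_(B' in Bnd n d) \sum_(t : Tt)
      (@flow_step n d ((B, B'), t) Z Z')%:R * (f Z - f Z') ^+ 2)) => [|Z' _].
      rewrite exchange_big /=; apply: eq_bigr => B _.
      rewrite exchange_big /=; apply: eq_bigr => B' _; exact: exchange_big.
    rewrite /cnt mulr_suml; apply: eq_bigr => B _; rewrite mulr_suml; apply: eq_bigr => B' _.
    exact: mulr_suml.
  rewrite !mulr_sumr; apply: ler_sum => B BB; rewrite !mulr_sumr; apply: ler_sum => B' BB'.
  rewrite T2E mulr_sumr; apply: ler_sum => t _.
  by apply: reach_energy; exact: (@flow_reach n d ((B, B'), t) BB BB').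
pose K : R := 16 * n%:R ^+ 3 * d%:R ^+ 12 * (NB%:R * T2) * (n%:R * d%:R) ^+ 2.
apply: (@le_trans _ _ ((n * d)%:R * (K * \sum_(B in Bnd n d) \sum_(B' in Bnd n d) P B B' * (f B - f B') ^+ 2))).
  apply: ler_wpM2l; first exact: ler0n.
  rewrite mulr_sumr [leRHS]big_mkcond /=; apply: ler_sum => Z _.
  apply: le_trans (ler_sum _ (fun Z' _ => cnt_le Z Z')) _.
  case ZB: (Z \in Bnd n d) => /=; last by rewrite big1.
  rewrite mulr_sumr [leRHS]big_mkcond /=; apply: ler_sum => Z' _; case: ifP => // _.
  rewrite /K le_eqVlt; apply/orP; left; apply/eqP; ring.
rewrite le_eqVlt; apply/orP; left; apply/eqP; rewrite /K /A natrM; ring.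
Qed.

End SwitchChain.

(** * Size of the state space and mixing time *)

Lemma bin_leq_expn m k : ('C(m, k) <= m ^ k)%N.
Proof.
have : (m ^_ k <= m ^ k)%N.
  elim: k => // k IH; rewrite ffactnSr expnSr; exact: leq_mul IH (leq_subr _ _).
apply: leq_trans; rewrite -bin_ffact; exact: leq_pmulr (fact_gt0 k).
Qed.

Lemma card_Bnd_le n d : (#|Bnd n d| <= n ^ (2 * (n * d)))%N.
Proof.
apply: (@leq_trans #|[set B : {set 'I_n * 'I_n} | #|B| == n * d]|%N).
  by apply: subset_leq_card; apply/subsetP=> B /card_Bnd BB; rewrite inE BB.
rewrite card_draws card_prod card_ord expnM expnS expn1; exact: bin_leq_expn.
Qed.

Section Mixing.
Variables (R : realType) (n d : nat).
Implicit Types B : bgraph n.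

Lemma switchPt_out B0 t B : B0 \in Bnd n d -> B \notin Bnd n d -> switchPt R t B0 B = 0.
Proof.
move=> B0B; elim: t B => [|t IH] B nB /=.
  by have -> : (B0 == B) = false by apply: contraNF nB => /eqP <-.
rewrite big1 // => C _; have [CB|nC] := boolP (C \in Bnd n d).
  by rewrite (switchP_out _ CB nB) mulr0.
by rewrite IH // mul0r.
Qed.

Lemma switchPtS B0 t B : B0 \in Bnd n d ->
  switchPt R t.+1 B0 B = push (Bnd n d) (@switchP R n) (switchPt R t B0) B.
Proof.
move=> B0B; rewrite /push [RHS]big_mkcond /=; apply: eq_bigr => C _.
by case: ifPn => // nC; rewrite switchPt_out // mul0r.
Qed.

Lemma switchPt0_sum B0 : B0 \in Bnd n d ->
  \sum_(B in Bnd n d) switchPt R 0 B0 B = 1 /\ \sum_(B in Bnd n d) switchPt R 0 B0 B ^+ 2 = 1.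
Proof.
move=> B0B; split; rewrite (bigD1 B0) //= eqxx big1 ?addr0 ?expr1n // => B /andP[_ ne];
by rewrite eq_sym (negbTE ne) ?expr0n.
Qed.

Lemma dTV_Bnd B0 t : B0 \in Bnd n d ->
  dTV (switchPt R t B0) (unifB R d) =
  2^-1 * \sum_(B in Bnd n d) `|switchPt R t B0 B - #|Bnd n d|%:R^-1|.
Proof.
move=> B0B; rewrite /dTV; congr (_ * _); rewrite [RHS]big_mkcond /=.
apply: eq_bigr => B _; rewrite /unifB; case: ifPn => // nB.
by rewrite switchPt_out // subrr normr0.
Qed.

Lemma mixing_decay B0 t (A : R) : (0 < n)%N -> (0 < d)%N -> B0 \in Bnd n d ->
  A = 16 * n%:R ^+ 6 * d%:R ^+ 15 ->
  (2 * dTV (switchPt R t B0) (unifB R d)) ^+ 2 <= #|Bnd n d|%:R * (1 - A^-1) ^+ t.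
Proof.
move=> n0 d0 B0B AE.
have A1 : 1 <= A.
  by rewrite AE -!natrX -!natrM ler1n 2!muln_gt0 !expn_gt0 n0 d0.
have A0 : 0 < A by apply: lt_le_trans A1.
rewrite dTV_Bnd // mulrA mulfV ?mul1r ?pnatr_eq0 //.
have [s1 s2] := switchPt0_sum B0B.
apply: (@iter_contract R _ (Bnd n d) (@switchP R n) A _ _ _ _ _ _ (fun t => switchPt R t B0)).
- by move=> *; apply: switchP_ge0.
- by move=> *; apply: (@switchP_sym R n d).
- by move=> *; apply: switchP_sum.
- by move=> *; apply: switchP_lazy.
- exact: A0.
- by rewrite AE; apply: switch_poincare.
- by move=> u B _; apply: switchPtS.
- exact: s1.
- by rewrite s2.
- by rewrite invf_le1.
- by apply/card_gt0P; exists B0.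
Qed.

Lemma dTV_trivial B0 t : B0 \in Bnd n d -> (n * d = 0)%N ->
  dTV (switchPt R t B0) (unifB R d) = 0.
Proof.
move=> B0B nd0; rewrite dTV_Bnd //.
have all0 B : B \in Bnd n d -> B = B0.
  have emp C : C \in Bnd n d -> C = set0.
    by move/card_Bnd; rewrite nd0 => /eqP; rewrite cards_eq0 => /eqP.
  by move=> /emp ->; rewrite (emp _ B0B).
have S1 : Bnd n d = [set B0].
  by apply/setP=> B; rewrite [RHS]inE; apply/idP/eqP => [/all0|->].
have s1 : \sum_(B in Bnd n d) switchPt R t B0 B = 1.
  elim: t => [|t IH]; first by case: (switchPt0_sum B0B).
  rewrite -IH -[RHS](sum_push (P := @switchP R n)); last by move=> *; apply: switchP_sum.
  by apply: eq_bigr => B _; apply: switchPtS.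
move: s1; rewrite S1 !big_set1 cards1 invr1 => ->.
by rewrite subrr normr0 mulr0.
Qed.

Lemma card_Bnd_expR : (0 < n)%N -> (0 < d)%N ->
  #|Bnd n d|%:R <= expR (2 * d%:R * n%:R * ln (2 * d%:R * n%:R)) :> R.
Proof.
move=> n0 d0; rewrite -!natrM [X in expR X]mulrC expRM_natr lnK ?posrE ?ltr0n ?muln_gt0 ?d0 ?n0 //.
rewrite -natrX ler_nat; apply: leq_trans (card_Bnd_le n d) _.
rewrite -mulnA [(d * n)%N]mulnC; rewrite leq_exp2r ?muln_gt0 ?n0 ?d0 //.
by rewrite mulnCA leq_pmulr // muln_gt0 d0.
Qed.
End Mixing.

(* tau(eps) <= bound  <=>  there is a T <= bound such that for every start
   B0 in B(n,d,d) and every t >= T, d_TV(P^t(B0,.), pi) <= eps. *)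
Theorem theoremA1 (R : realType) (n d : nat) (eps : R) :
  0 < eps -> eps < 1 ->
  exists T : nat,
    (T%:R <= 32 * (d%:R) ^+ 17 * (n%:R) ^+ 6 *
             (2 * d%:R * n%:R * ln (2 * d%:R * n%:R) + ln (eps^-1)) :> R) /\
    forall B0 : bgraph n, B0 \in Bnd n d ->
      forall t : nat, (T <= t)%N ->
        dTV (switchPt R t B0) (unifB R d) <= eps.
Proof.
move=> e0 e1.
have [nd0|nd_gt0] := posnP (n * d)%N.
  (* If [n * d = 0], only the empty graph is regular and the bound is 0. *)
  exists 0%N; split=> [|B0 B0B t _]; last by rewrite dTV_trivial // ltW.
  have : (n == 0)%N || (d == 0)%N by rewrite -muln_eq0 nd0.
  by case/orP=> /eqP ->; rewrite ?expr0n /= ?mulr0 ?mul0r.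
have /andP[n0 d0] : (0 < n)%N && (0 < d)%N by rewrite -muln_gt0.
set D : R := 2 * d%:R * n%:R.
have D1 : 1 <= D by rewrite /D -!natrM ler1n !muln_gt0 d0 n0.
have lnD : 0 <= ln D by apply: ln_ge0.
set L := ln eps^-1.
have L0 : 0 <= L by apply: ln_ge0; rewrite invf_ge1 ?ltW.
set M := D * ln D + L.
have M0 : 0 <= M by rewrite addr_ge0 // mulr_ge0 // (le_trans ler01).
pose A : R := 16 * n%:R ^+ 6 * d%:R ^+ 15.
have A16 : 16 <= A.
  rewrite /A -!natrX -!natrM ler_nat -mulnA leq_pmulr // muln_gt0 !expn_gt0 n0 d0 //.
have A0 : 0 < A by apply: lt_le_trans A16; rewrite ltr0n.
have AT : 2 * A <= 32 * d%:R ^+ 17 * n%:R ^+ 6.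
  rewrite /A -!natrX -!natrM ler_nat.
  have : (d ^ 15 <= d ^ 17)%N by rewrite leq_pexp2l.
  move: (d ^ 15)%N (d ^ 17)%N (n ^ 6)%N => a b c ab.
  by rewrite [in X in (X <= _)%N]mulnA mulnA -mulnAC leq_mul // leq_mul.
set bound := 32 * d%:R ^+ 17 * n%:R ^+ 6 * M.
have bound0 : 0 <= bound by rewrite /bound -!natrX -!natrM mulr_ge0 ?ler0n.
have /andP[Tle Tgt] := truncn_itv bound0.
exists (Num.truncn bound); split=> // B0 B0B t Tt.
(* Rounding the bound down to an integer loses less than one step, hence the term [A^-1]. *)
have tA : 2 * M - A^-1 <= t%:R * A^-1.
  have h : 2 * A * M <= t%:R + 1.
    apply: le_trans (ler_wpM2r M0 AT) _; apply: ltW; apply: lt_le_trans Tgt _.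
    by rewrite natr1 ler_nat.
  have : 2 * M <= (t%:R + 1) * A^-1.
    by rewrite ler_pdivlMr // -mulrA [M * A]mulrC mulrA.
  have -> : (t%:R + 1) * A^-1 = t%:R * A^-1 + A^-1 by ring.
  by move=> h2; rewrite lerBlDr.
have iA : A^-1 <= 2^-1 by rewrite lef_pV2 ?posrE // (le_trans _ A16) // ler_nat.
have dec := mixing_decay t n0 d0 B0B (erefl A).
have pw : (1 - A^-1) ^+ t <= expR (- (t%:R * A^-1)).
  rewrite -mulrN mulrC expRM_natr; apply: lerXn2r; rewrite ?nnegrE ?expR_ge0 //.
    by rewrite subr_ge0 (le_trans iA) // invf_le1 // ler1n.
  exact: expR_ge1Dx.
have eA : expR A^-1 <= 2.
  have h1 : 2^-1 <= expR (- A^-1) by apply: le_trans (expR_ge1Dx _); lra.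
  by rewrite -[A^-1]opprK expRN -[leRHS]invrK lef_pV2 ?posrE ?expR_gt0 ?invr_gt0.
(* In [2 * M], one [D * ln D] cancels the number of graphs and [2 * L] gives [eps ^+ 2]; the
   rounding factor [expR A^-1 <= 2] is absorbed by the 4 on the right. *)
have fin : (2 * dTV (switchPt R t B0) (unifB R d)) ^+ 2 <= (2 * eps) ^+ 2.
  apply: le_trans dec _.
  apply: (@le_trans _ _ (expR (D * ln D) * expR (- (2 * M - A^-1)))).
    apply: ler_pM; rewrite ?ler0n //.
    - by apply: exprn_ge0; rewrite subr_ge0 (le_trans iA) // invf_le1 // ler1n.
    - exact: card_Bnd_expR.
    - by apply: le_trans pw _; rewrite ler_expR lerN2.
  have -> : expR (D * ln D) * expR (- (2 * M - A^-1)) =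
     expR (- (D * ln D)) * expR A^-1 * eps ^+ 2.
    have -> : eps ^+ 2 = expR (- (2 * L)).
      by rewrite /L lnV ?posrE // mulrN opprK mulrC expRM_natr lnK ?posrE.
    rewrite -!expRD; congr expR; rewrite /M; ring.
  have h1 : expR (- (D * ln D)) <= 1 by rewrite -expR0 ler_expR oppr_le0 mulr_ge0 // (le_trans ler01).
  have h2 : expR (- (D * ln D)) * expR A^-1 <= 4.
    apply: le_trans (ler_pM (expR_ge0 _) (expR_ge0 _) h1 eA) _; lra.
  rewrite exprMn; apply: ler_wpM2r; first exact: sqr_ge0.
  by apply: le_trans h2 _; lra.
have dge : 0 <= dTV (switchPt R t B0) (unifB R d).
  by rewrite /dTV mulr_ge0 ?invr_ge0 // sumr_ge0.
move: fin; rewrite ler_sqr ?nnegrE; [move: (dTV _ _) => v|by apply: mulr_ge0|].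
  lra.
by apply: mulr_ge0 => //; exact: ltW.
Qed.
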